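(* Let $\mathcal{Q}$ be a flat logarithmic quantum differential system on $M=\mathbb{C}$, whose connection $\nabla$ has in the basis $\omega=(\omega_0,\dots,\omega_{\mu-1})$ the matrix $\tau M_1(x)\frac{dx}{x}+(N_0(x)+N_1(x)\tau)\frac{d\tau}{\tau}$, and let $H(x,\tau)$ be the matrix of holomorphic functions on $(\mathbb{C},0)\times\mathbb{C}$ with $H(0,\tau)=I$ such that $P(x,\tau)=H(x,\tau)e^{-\tau M_1(0)\ln x}$ is a fundamental solution of the Dubrovin connection. 1. Any basis of flat sections of $\nabla$ takes the form $(\omega_0,\dots,\omega_{\mu-1})\Psi$ where $$\Psi(x,\tau)=H(x,\tau)e^{-\tau M_1(0)\ln x}\Psi^{cl}(\tau),$$ the matrix $\Psi^{cl}(\tau)$ satisfying $\tau\partial_\tau\Psi^{cl}(\tau)=-(N_0(0)+\tau N_1(0))\Psi^{cl}(\tau)$. 2. If moreover $P(x,\tau)=H(x,\tau)e^{-\tau M_1(0)\ln x}$ is conformal, we have $$\Psi^{cl}(\tau)=\tau^{-N_0(0)}\tau^{-N_1(0)}\Psi^{const}$$ where $\Psi^{const}$ is a constant matrix.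
   Context: Let $\theta$ be the coordinate on $\mathbb{P}^1$ centered at $0$, $\tau=\theta^{-1}$, $j(\theta,x)=(-\theta,x)$. A flat logarithmic quantum differential system on $M=\mathbb{C}$ (coordinate $x$) is a tuple $(M,\mathcal{G},\nabla,S,d)$, $d\in\mathbb{Z}$, where $\mathcal{G}$ is a holomorphic bundle on $\mathbb{P}^1\times M$ with a basis $\omega$ of global sections, $\nabla$ is a flat meromorphic connection on $\mathcal{G}$ whose matrix in $\omega$ is of the displayed form with $M_1,N_0,N_1$ holomorphic on $\mathbb{C}$, and $S:\mathcal{O}(\mathcal{G})\times j^*\mathcal{O}(\mathcal{G})\to\theta^d\mathcal{O}_{\mathbb{P}^1\times M}$ is a $\nabla$-flat non-degenerate bilinear form. The endomorphism with matrix $N_0(x)$ is assumed semi-simple. Flat sections are multivalued in $x\ne0$ and $\tau\neq0$. Convention: $\nabla(\omega v)=\omega(dv+\Omega v)$; after the base change of matrix $P$ the matrix is $P^{-1}\Omega P+P^{-1}dP$. The Dubrovin connection $\nabla^d$ is the part of $\nabla$ in the direction of $M$, with matrix $\tau M_1(x)\frac{dx}{x}$. A fundamental solution is an invertible matrix $P(x,\tau)=P_0(x)+\sum_{i\ge1}P_i(x)\tau^i$ (coefficients multivalued holomorphic in $x\neq0$, $P_0$ invertible) with $\nabla^d(\omega P)=0$; a matrix $H$ as in the statement exists and is unique. A fundamental solution is conformal if after the base change of matrix $P$ the matrix of $\nabla$ is $(R_0+R_1\tau+\cdots+R_\delta\tau^\delta)\frac{d\tau}{\tau}$ with constant $R_k$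 satisfying $[R_0,R_k]=-kR_k$ for all $k\ge1$. *)

(* Defs.v *)
From HB Require Import structures.
From mathcomp Require Import all_boot all_order all_algebra.
From mathcomp Require Import complex.
From mathcomp Require Import all_classical all_reals all_analysis.

Set Implicit Arguments.
Unset Strict Implicit.
Unset Printing Implicit Defensive.

Import Order.TTheory GRing.Theory Num.Theory.
Import numFieldNormedType.Exports.
Local Open Scope classical_set_scope.
Local Open Scope ring_scope.

(* R[i], typed so that it carries the topology and the normed module structure
   that MathComp-Analysis attaches to every numFieldType. *)
Definition Cplx (R : realType) : numClosedFieldType := R[i].

(* Used with D open; over the base field C, Frechet differentiability is
   complex differentiability. *)
Definition holomorphic (R : realType) (V W : normedModType (Cplx R))
    (D : set V) (f : V -> W) : Prop :=
  forall p, D p -> differentiable f p.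

Definition cexp (R : realType) (z : Cplx R) : Cplx R :=
  limn (series (fun k : nat => (k`!%:R)^-1 * z ^+ k : Cplx R)).

Definition mexp (R : realType) (n : nat) (A : 'M[Cplx R]_n) : 'M[Cplx R]_n :=
  limn (series (fun k : nat => (k`!%:R)^-1 *: A ^+ k : 'M[Cplx R]_n)).

(* The matrix t^A at the point v = ln t of the universal cover of C \ {0}. *)
Definition mpow (R : realType) (n : nat) (v : Cplx R) (A : 'M[Cplx R]_n) :
    'M[Cplx R]_n :=
  mexp (v *: A).

(* The open disc of radius r, which is all of C for r = +oo. *)
Definition disc (R : realType) (r : \bar R) : set (Cplx R) :=
  [set x | ((Normc.normc x)%:E < r)%E].

(* The universal cover of disc r \ {0}: the point u lies over x = exp u, and
   u is the value of ln x there.  A multivalued function of x <> 0 is a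
   function of u, and x d/dx becomes d/du. *)
Definition logdisc (R : realType) (r : \bar R) : set (Cplx R) :=
  [set u | disc r (cexp u)].

(* A acts on column vectors and MathComp subspaces are row spaces, whence the
   transposes. *)
Definition semisimple_mx (R : realType) (n : nat) (A : 'M[Cplx R]_n) : Prop :=
  forall V : 'M[Cplx R]_n, stablemx V A^T ->
    exists W : 'M[Cplx R]_n,
      [/\ stablemx W A^T, (V + W :=: 1%:M)%MS & (V :&: W)%MS = 0].

(* Points of C * C are pairs (x, tau).  A connection matrix is given by its
   coefficients (A, B) on the closed forms dx/x and dtau/tau. *)
Definition xdx (R : realType) (m n : nat)
    (F : Cplx R * Cplx R -> 'M[Cplx R]_(m, n)) (p : Cplx R * Cplx R) :
    'M[Cplx R]_(m, n) :=
  p.1 *: 'D_(1, 0) F p.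

Definition tdt (R : realType) (m n : nat)
    (F : Cplx R * Cplx R -> 'M[Cplx R]_(m, n)) (p : Cplx R * Cplx R) :
    'M[Cplx R]_(m, n) :=
  p.2 *: 'D_(0, 1) F p.

Definition torus (R : realType) : set (Cplx R * Cplx R) :=
  [set p | p.1 != 0 /\ p.2 != 0].

(* d Omega + Omega /\ Omega = 0 for Omega = A dx/x + B dtau/tau. *)
Definition flat_connection (R : realType) (n : nat)
    (A B : Cplx R * Cplx R -> 'M[Cplx R]_n) : Prop :=
  forall p, @torus R p ->
    xdx B p - tdt A p + (A p *m B p - B p *m A p) = 0.

(* G is the Gram matrix (S(omega_i, j^* omega_j)) on tau <> 0.  It represents a
   non-degenerate pairing with values in theta^d O over P^1 x M: theta^-d G
   extends holomorphically and invertibly to the chart with coordinates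
   (x, theta) as s0 and to the chart with coordinates (x, tau) as soo. *)
Definition nondegenerate_pairing (R : realType) (n : nat) (d : int)
    (G : Cplx R * Cplx R -> 'M[Cplx R]_n) : Prop :=
  exists s0 soo : Cplx R * Cplx R -> 'M[Cplx R]_n,
    [/\ holomorphic setT s0 /\ holomorphic setT soo,
        forall p, s0 p \in unitmx,
        forall p, soo p \in unitmx,
        forall x tau : Cplx R, tau != 0 ->
          G (x, tau) = (tau^-1) ^ d *: s0 (x, tau^-1)
      & forall x tau : Cplx R, tau != 0 ->
          G (x, tau) = (tau^-1) ^ d *: soo (x, tau)].

(* d S(a, b) = S(nabla a, b) + S(a, (j^* nabla) b) in Gram matrices; dx/x and
   dtau/tau are both invariant under j : tau |-> - tau. *)
Definition flat_pairing (R : realType) (n : nat)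
    (A B G : Cplx R * Cplx R -> 'M[Cplx R]_n) : Prop :=
  forall p, @torus R p ->
    xdx G p = (A p)^T *m G p + G p *m A (p.1, - p.2) /\
    tdt G p = (B p)^T *m G p + G p *m B (p.1, - p.2).

Definition conn_x (R : realType) (n : nat) (M1 : Cplx R -> 'M[Cplx R]_n)
    (p : Cplx R * Cplx R) : 'M[Cplx R]_n :=
  p.2 *: M1 p.1.

Definition conn_tau (R : realType) (n : nat) (N0 N1 : Cplx R -> 'M[Cplx R]_n)
    (p : Cplx R * Cplx R) : 'M[Cplx R]_n :=
  N0 p.1 + p.2 *: N1 p.1.

(* A flat logarithmic quantum differential system on M = C of rank mu, written
   in the given basis of global sections, which trivializes the bundle. *)
Record logQDS (R : realType) (mu : nat) := LogQDS {
  q_d : int;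
  q_M1 : Cplx R -> 'M[Cplx R]_mu;
  q_N0 : Cplx R -> 'M[Cplx R]_mu;
  q_N1 : Cplx R -> 'M[Cplx R]_mu;
  q_S : Cplx R * Cplx R -> 'M[Cplx R]_mu;
  _ : holomorphic setT q_M1;
  _ : holomorphic setT q_N0;
  _ : holomorphic setT q_N1;
  _ : flat_connection (conn_x q_M1) (conn_tau q_N0 q_N1);
  _ : nondegenerate_pairing q_d q_S;
  _ : flat_pairing (conn_x q_M1) (conn_tau q_N0 q_N1) q_S;
  _ : forall x, semisimple_mx (q_N0 x)
}.

(* Flat multivalued sections omega Y over x in disc r \ {0}, tau <> 0, as
   functions of (u, v) = (ln x, ln tau). *)
Definition flat_section (R : realType) (mu : nat) (Q : logQDS R mu)
    (r : \bar R) (Y : Cplx R * Cplx R -> 'cV[Cplx R]_mu) : Prop :=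
  holomorphic (logdisc r `*` setT) Y /\
  forall u v : Cplx R, logdisc r u ->
    'D_(1, 0) Y (u, v) + conn_x (q_M1 Q) (cexp u, cexp v) *m Y (u, v) = 0 /\
    'D_(0, 1) Y (u, v)
      + conn_tau (q_N0 Q) (q_N1 Q) (cexp u, cexp v) *m Y (u, v) = 0.

Definition flat_basis (R : realType) (mu : nat) (Q : logQDS R mu)
    (r : \bar R) (Psi : Cplx R * Cplx R -> 'M[Cplx R]_mu) : Prop :=
  (forall j : 'I_mu, flat_section Q r (fun p => col j (Psi p))) /\
  forall Y, flat_section Q r Y ->
    exists! c : 'cV[Cplx R]_mu,
      forall u v : Cplx R, logdisc r u -> Y (u, v) = Psi (u, v) *m c.

(* P is a function of (u, tau) with u = ln x: only its dependence on x is
   multivalued.  The equation in u says that omega P is flat for the Dubrovin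
   connection. *)
Definition fundamental_solution (R : realType) (mu : nat) (Q : logQDS R mu)
    (r : \bar R) (P : Cplx R * Cplx R -> 'M[Cplx R]_mu) : Prop :=
  [/\ holomorphic (logdisc r `*` setT) P,
      forall u tau : Cplx R, logdisc r u -> P (u, tau) \in unitmx,
      exists Pi : nat -> Cplx R -> 'M[Cplx R]_mu,
        [/\ forall i, holomorphic (logdisc r) (Pi i),
            forall u : Cplx R, logdisc r u -> Pi 0%N u \in unitmx
          & forall u tau : Cplx R, logdisc r u ->
              series (fun i : nat => tau ^+ i *: Pi i u) @ \oo --> P (u, tau)]
    & forall u tau : Cplx R, logdisc r u ->
        'D_(1, 0) P (u, tau) + conn_x (q_M1 Q) (cexp u, tau) *m P (u, tau) = 0].

(* The two equations give the coefficients on dx/x = du and on dtau/tau of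
   P^-1 Omega P + P^-1 dP. *)
Definition conformal (R : realType) (mu : nat) (Q : logQDS R mu)
    (r : \bar R) (P : Cplx R * Cplx R -> 'M[Cplx R]_mu) : Prop :=
  fundamental_solution Q r P /\
  exists (delta : nat) (Rk : nat -> 'M[Cplx R]_mu),
    (forall k : nat, (1 <= k <= delta)%N ->
       Rk 0%N *m Rk k - Rk k *m Rk 0%N = - (k%:R *: Rk k)) /\
    forall u tau : Cplx R, logdisc r u -> tau != 0 ->
      invmx (P (u, tau)) *m conn_x (q_M1 Q) (cexp u, tau) *m P (u, tau)
        + invmx (P (u, tau)) *m 'D_(1, 0) P (u, tau) = 0 /\
      invmx (P (u, tau)) *m conn_tau (q_N0 Q) (q_N1 Q) (cexp u, tau)
          *m P (u, tau)
        + invmx (P (u, tau)) *m tdt P (u, tau)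
      = \sum_(k < delta.+1) tau ^+ k *: Rk k.

(* H(x, tau) e^(- tau M_1(0) ln x), as a function of (ln x, tau). *)
Definition twisted_solution (R : realType) (mu : nat) (Q : logQDS R mu)
    (H : Cplx R * Cplx R -> 'M[Cplx R]_mu) (p : Cplx R * Cplx R) :
    'M[Cplx R]_mu :=
  H (cexp p.1, p.2) *m mexp (- (p.2 * p.1) *: q_M1 Q 0).

(* Main.v *)
(** Fix k and put u = - k, s = - k tau, M = M_1(0), x = exp u.  A flat section is
    P(u, tau) G(tau) with G independent of u, since both factors solve the same
    linear equation in u.  Multiplied by e^(s M) it satisfies in ln tau an
    equation with matrix - (e^(s M) B(x, tau) e^(- s M) - s M), where
    B = N_0 + tau N_1.  Flatness at x = 0 gives [M, B(0, tau)] = M; hence M is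
    nilpotent and the matrix equals
    - B(0, tau) - e^(s M) (B(x, tau) - B(0, tau)) e^(- s M).  As k goes to infinity,
    x = e^(- k) beats the polynomial growth of e^(s M): the equations converge
    to the classical one and their solutions to G.  By stability of linear
    equations under such limits G is a classical solution.  This needs no
    continuity of derivatives of H or P, hence no Cauchy theory.

    The same limit applied to P itself, with G = 1, shows that the matrix of a
    conformal connection is N_0(0) + tau N_1(0), so that [N_0(0), N_1(0)] is
    - N_1(0) and the classical equation is solved explicitly. *)
Require Import Defs.
From HB Require Import structures.
From mathcomp Require Import all_boot all_order all_algebra.
From mathcomp Require Import complex.
From mathcomp Require Import all_classical all_reals all_analysis.
From mathcomp Require Import ring lra.
Import Order.TTheory GRing.Theory Num.Theory.
Import numFieldNormedType.Exports.
Local Open Scope classical_set_scope.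
Local Open Scope ring_scope.

Set Implicit Arguments.
Unset Strict Implicit.
Unset Printing Implicit Defensive.

(** The factor e^(- tau M ln x) has in general no limit at x = 0, so P cannot be evaluated there to
    isolate G. Left multiplication by e^(s M) replaces P by e^(s M) H e^(- s M), which tends to 1: H
    - 1 = O(x) follows from differentiability of H at x = 0 alone. Conjugating B produces the
    divergent term s M; differentiating e^(s M) in ln tau removes exactly this term, since s is
    proportional to tau. The limit of solutions solves the limit equation because a Gronwall
    estimate bounds the solutions near a point uniformly in k, so that their linear approximations
    have errors uniform in k. Both uses of the limit share one statement about equations Y' = Y T -
    B Y. The right factor T is 0 for flat sections and is the matrix of the conformal connection for
    Y = P. In the second case G = 1 has derivative 0, which forces T = N_0(0) + tau N_1(0).
    Comparing coefficients of tau identifies R_0 with N_0(0) and R_1 with N_1(0), and the conformal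
    relation for k = 1 becomes the commutation relation. *)

Local Notation "x %:C" := (real_complex_def (Phant _) x : Cplx _).

(** Norms in a normed module over [Cplx R] are complex numbers. Their real part gives access to the
    total order, to [lra] and [nra], and to theorems of real analysis. *)
Definition nrm (R : realType) (V : normedModType (Cplx R)) (x : V) : R :=
  complex.Re `|x|.

(** * Real-valued norms on complex normed spaces *)

Section Norm.
Variables (R : realType) (V : normedModType (Cplx R)).
Implicit Types (x y : V) (a : Cplx R).

Lemma normrC x : `|x| = (nrm x)%:C.
Proof. by rewrite RRe_real // normr_real. Qed.

Lemma leC (s t : R) : (s%:C <= t%:C) = (s <= t).
Proof. by rewrite lecE eqxx. Qed.

Lemma ltC (s t : R) : (s%:C < t%:C) = (s < t).
Proof. by rewrite ltcE eqxx. Qed.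

Lemma gt0C (e : Cplx R) : 0 < e -> exists2 d : R, 0 < d & e = d%:C.
Proof.
move=> e0; exists (complex.Re e); first by move: e0; rewrite ltcE => /andP[].
by rewrite RRe_real // gtr0_real.
Qed.

Lemma nrm_ge0 x : 0 <= nrm x.
Proof. by rewrite -leC -normrC normr_ge0. Qed.

Lemma nrm0 : nrm (0 : V) = 0. Proof. by rewrite /nrm normr0. Qed.

Lemma nrm0_eq0 x : nrm x = 0 -> x = 0.
Proof. by move=> x0; apply/eqP; rewrite -normr_eq0 normrC x0. Qed.

Lemma nrmN x : nrm (- x) = nrm x. Proof. by rewrite /nrm normrN. Qed.

Lemma nrmB x y : nrm (x - y) = nrm (y - x). Proof. by rewrite /nrm distrC. Qed.

Lemma ler_nrmD x y : nrm (x + y) <= nrm x + nrm y.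
Proof.
have := ler_normD x y; rewrite !normrC -rmorphD /=.
by rewrite leC.
Qed.

Lemma ler_nrm_sum (I : Type) (r : seq I) (P : pred I) (F : I -> V) :
  nrm (\sum_(i <- r | P i) F i) <= \sum_(i <- r | P i) nrm (F i).
Proof.
elim/big_rec2: _ => [|i y1 y2 _ IH]; first by rewrite nrm0.
by apply: le_trans (ler_nrmD _ _) _; rewrite lerD2l.
Qed.

Lemma ler_nrmB x y : nrm (x - y) <= nrm x + nrm y.
Proof. by rewrite -(nrmN y) ler_nrmD. Qed.

Lemma nrmZ a x : nrm (a *: x) = nrm a * nrm x.
Proof. by rewrite {1}/nrm normrZ !normrC -rmorphM. Qed.

Lemma nrm_small_eq0 x : (forall e : R, 0 < e -> nrm x <= e) -> x = 0.
Proof.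
move=> H; apply: nrm0_eq0; apply/eqP; rewrite eq_le nrm_ge0 andbT.
by apply/ler_addgt0Pl => e e0; rewrite addr0 H.
Qed.

Lemma cvg_nrmP (u : nat -> V) (l : V) :
  u @ \oo --> l <->
  forall e : R, 0 < e -> exists N, forall k, (N <= k)%N -> nrm (u k - l) <= e.
Proof.
split => [/cvgrPdist_le H e e0|H].
  have /H [N _ HN] : 0 < e%:C by rewrite ltC.
  by exists N => k Nk; have := HN k Nk; rewrite /= normrC leC nrmB.
apply/cvgrPdist_le => _ /gt0C[e e0 ->].
have [N HN] := H e e0; exists N => // k Nk /=.
by rewrite normrC leC nrmB HN.
Qed.

End Norm.

Lemma nrmM (R : realType) (a b : Cplx R) : nrm (a * b) = nrm a * nrm b.
Proof. exact: (nrmZ a b). Qed.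

Lemma nrm1 (R : realType) : nrm (1 : Cplx R) = 1.
Proof. by rewrite /nrm normr1. Qed.

Lemma nrmV (R : realType) (a : Cplx R) : nrm a^-1 = (nrm a)^-1.
Proof.
have [->|a0] := eqVneq a 0; first by rewrite invr0 nrm0 invr0.
have na0 : nrm a != 0 by apply: contra_neq a0; exact: nrm0_eq0.
by apply: (mulfI na0); rewrite -nrmM !divff // nrm1.
Qed.

Lemma nrmX (R : realType) (a : Cplx R) k : nrm (a ^+ k) = nrm a ^+ k.
Proof. by elim: k => [|k IH]; rewrite ?expr0 ?nrm1 // !exprS nrmM IH. Qed.

Lemma nrm_real (R : realType) (t : R) : nrm (t%:C) = `|t|.
Proof. by rewrite /nrm normc_def /= expr0n addr0 sqrtr_sqr. Qed.

Lemma nrm_natr (R : realType) n : nrm (n%:R : Cplx R) = n%:R.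
Proof. by rewrite /nrm normr_nat -(rmorph_nat (real_complex R)). Qed.

Lemma nrm_normc (R : realType) (z : Cplx R) : nrm z = Normc.normc z.
Proof. by rewrite /nrm normc_def; case: z. Qed.

Lemma nrm_Re (R : realType) (z : Cplx R) : `|complex.Re z| <= nrm z.
Proof. by have := normc_ge_Re z; rewrite -leC -normrC. Qed.

Lemma nrm_Im (R : realType) (z : Cplx R) : `|complex.Im z| <= nrm z.
Proof.
rewrite /nrm normc_def /= -sqrtr_sqr ler_wsqrtr // lerDr sqr_ge0 //.
Qed.

Lemma nrm_ReIm (R : realType) (z : Cplx R) :
  nrm z <= `|complex.Re z| + `|complex.Im z|.
Proof.
rewrite {1}(complexE z); apply: le_trans (ler_nrmD _ _) _.
by rewrite nrmM !nrm_real lerD2l /nrm normc_def /= expr0n expr1n add0r sqrtr1 mul1r.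
Qed.

Section NormMatrix.
Variables (R : realType).

(** The norm of a matrix is the largest norm of its entries, and 0 for an empty matrix; hence the
    condition on [c]. *)
Lemma nrm_mxP m n (A : 'M[Cplx R]_(m, n)) (c : R) : 0 <= c ->
  reflect (forall i j, nrm (A i j) <= c) (nrm A <= c).
Proof.
move=> c0; have -> : (nrm A <= c) = (`|A| <= c%:C) by rewrite normrC leC.
have c0' : 0 <= c%:C by rewrite -[0]/(0%:C) leC.
pose c' := NngNum c0'.
rewrite {1}/Num.Def.normr/= mx_normE -[c%:C]/(c'%:num) num_le.
apply: (iffP idP) => [/bigmax_leP[_ H] i j|H].
  by have := H (i, j) isT; rewrite -num_le /= normrC leC.
apply/bigmax_leP; split; first by rewrite -num_le.
by move=> [i j] _; rewrite -num_le /= normrC leC.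
Qed.

Lemma nrm_mxE m n (A : 'M[Cplx R]_(m, n)) i j : nrm (A i j) <= nrm A.
Proof. by move: i j; apply/nrm_mxP; rewrite ?nrm_ge0. Qed.

(** The maximum norm is not submultiplicative: an entry of the product is a sum of [n] products. *)
Lemma nrm_mulmx m n p (A : 'M[Cplx R]_(m, n)) (B : 'M[Cplx R]_(n, p)) :
  nrm (A *m B) <= n%:R * (nrm A * nrm B).
Proof.
apply/nrm_mxP => [|i j]; first by rewrite !mulr_ge0 ?nrm_ge0.
rewrite mxE; apply: (@le_trans _ _ (\sum_(k < n) nrm A * nrm B)).
  apply: le_trans (ler_nrm_sum _ _ _) _; apply: ler_sum => k _.
  by rewrite nrmM ler_pM ?nrm_ge0 ?nrm_mxE.
by rewrite sumr_const card_ord mulr_natl.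
Qed.

End NormMatrix.

(** * Directional derivatives as linear approximations *)

Section Derivative.
Variables (R : realType).
Implicit Types (V W : normedModType (Cplx R)).

(** Multiplying the difference quotient by [h] gives a condition that makes sense at h = 0 too, so
    that punctured neighbourhoods disappear from the later estimates. *)
Lemma is_derive_nrmP V W (f : V -> W) (p v : V) (L : W) :
  is_derive p v f L <->
  forall e : R, 0 < e -> exists2 d : R, 0 < d & forall h : Cplx R,
    nrm h <= d -> nrm (f (p + h *: v) - f p - h *: L) <= e * nrm h.
Proof.
have quot (h : Cplx R) (e : R) : h != 0 ->
    (`|L - h^-1 *: (f (h *: v + p) - f p)| <= e%:C) =
    (nrm (f (p + h *: v) - f p - h *: L) <= e * nrm h).
  move=> h0; have nh : 0 < nrm h.
    by rewrite lt_def nrm_ge0 andbT; apply: contra_neq h0; exact: nrm0_eq0.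
  rewrite normrC leC nrmB [p + _]addrC.
  rewrite -(ler_pM2r nh) mulrC -nrmZ scalerBr scalerA divff // scale1r.
  by [].
split=> [[/cvg_ex[l Hl] HL] e e0|H].
  have {HL} El : l = L by rewrite -HL; apply/esym/cvg_lim.
  subst l; move/cvgrPdist_le: Hl => /(_ e%:C).
  rewrite -[0]/(0%:C) ltC => /(_ e0)[_ /gt0C[d d0 ->] Hd].
  (* Half the radius passes from the open ball to the closed condition on [h]. *)
  exists (d / 2); first by rewrite divr_gt0.
  move=> h hd; have [->|h0] := eqVneq h 0.
    by rewrite !scale0r addr0 !subrr nrm0 nrm0 mulr0.
  rewrite -quot //; apply: Hd => //=.
  by rewrite sub0r normrN normrC ltC; lra.
suff HL : h^-1 *: ((f \o shift p) (h *: v) - f p) @[h --> 0^'] --> L.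
  by split; [apply/cvg_ex; exists L|exact/cvg_lim].
apply/cvgrPdist_le => _ /gt0C[e e0 ->].
have [d d0 Hd] := H e e0; exists d%:C; first by rewrite /= -[0]/(0%:C) ltC.
move=> h /=; rewrite sub0r normrN normrC ltC => hd h0.
by rewrite quot // Hd // ltW.
Qed.

Lemma is_derive_lip V W (f : V -> W) (p v : V) (L : W) : is_derive p v f L ->
  exists2 d : R, 0 < d & forall h : Cplx R,
    nrm h <= d -> nrm (f (p + h *: v) - f p) <= (nrm L + 1) * nrm h.
Proof.
move=> /is_derive_nrmP/(_ 1 ltr01)[d d0 Hd]; exists d => // h hd.
rewrite -[f _ - _](subrK (h *: L)); apply: le_trans (ler_nrmD _ _) _.
by rewrite nrmZ mulrDl addrC [nrm L * _]mulrC lerD2l Hd.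
Qed.

Lemma is_derive_mulmx V m n p (f : V -> 'M[Cplx R]_(m, n))
    (g : V -> 'M[Cplx R]_(n, p)) (x v : V) df dg :
  is_derive x v f df -> is_derive x v g dg ->
  is_derive x v (fun y => f y *m g y) (df *m g x + f x *m dg).
Proof.
move=> Hf Hg; apply/is_derive_nrmP => e e0.
have [d1 d10 L1] := is_derive_lip Hf; have [d2 d20 L2] := is_derive_lip Hg.
pose a := nrm df + 1; pose b := nrm dg + 1.
have a0 : 0 <= a by rewrite addr_ge0 ?nrm_ge0.
have b0 : 0 <= b by rewrite addr_ge0 ?nrm_ge0.
(* The remainder of the product has two first-order terms and the product of the increments. [c]
   sums their coefficients, once the quadratic term has given up one factor [nrm h] for e / c. *)
pose c := n%:R * (nrm (g x) + nrm (f x) + a * b) + 1 : R.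
have c0 : 0 < c.
  by rewrite ltr_wpDl // mulr_ge0 // !addr_ge0 ?mulr_ge0 ?nrm_ge0.
have ec0 : 0 < e / c by rewrite divr_gt0.
move/is_derive_nrmP: Hf => /(_ _ ec0)[d3 d30 H1].
move/is_derive_nrmP: Hg => /(_ _ ec0)[d4 d40 H2].
exists (Num.min (Num.min d1 d2) (Num.min (Num.min d3 d4) (e / c))).
  by rewrite !lt_min d10 d20 d30 d40.
move=> h; rewrite !le_min => /andP[/andP[h1 h2] /andP[/andP[h3 h4] h5]].
have -> : f (x + h *: v) *m g (x + h *: v) - f x *m g x
    - h *: (df *m g x + f x *m dg) =
  (f (x + h *: v) - f x - h *: df) *m g x
  + f x *m (g (x + h *: v) - g x - h *: dg)
  + (f (x + h *: v) - f x) *m (g (x + h *: v) - g x).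
  set F := f (x + _); set G := g (x + _).
  rewrite !mulmxBl !mulmxBr -!scalemxAl -!scalemxAr scalerDr.
  rewrite !opprD !opprK; move: (F *m G) (F *m g x) (f x *m G) (f x *m g x).
  move=> x1 x2 x3 x4; move: (h *: _) (h *: _) => x5 x6.
  apply/matrixP => i j; rewrite !mxE; ring.
have {}H1 := H1 h h3; have {}H2 := H2 h h4.
have {}L1 := L1 h h1; have {}L2 := L2 h h2.
apply: (@le_trans _ _ (n%:R * (e / c * nrm h * nrm (g x))
   + n%:R * (nrm (f x) * (e / c * nrm h)) + n%:R * (a * nrm h * (b * nrm h)))).
  apply: le_trans (ler_nrmD _ _) _; apply: lerD.
    apply: le_trans (ler_nrmD _ _) _; apply: lerD.
      apply: le_trans (nrm_mulmx _ _) _.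
      by rewrite ler_wpM2l // ler_wpM2r ?nrm_ge0.
    apply: le_trans (nrm_mulmx _ _) _.
    by rewrite ler_wpM2l // ler_wpM2l ?nrm_ge0.
  apply: le_trans (nrm_mulmx _ _) _.
  by rewrite ler_wpM2l // ler_pM ?nrm_ge0.
apply: (@le_trans _ _ (n%:R * (e / c * nrm h * nrm (g x))
   + n%:R * (nrm (f x) * (e / c * nrm h)) + n%:R * (a * nrm h * (b * (e / c))))).
  rewrite lerD2l ler_wpM2l // ler_wpM2l ?ler_wpM2l //.
  by rewrite mulr_ge0 ?nrm_ge0.
have -> : e * nrm h = c * (e / c) * nrm h by rewrite [c * _]mulrC divfK ?gt_eqF.
rewrite [X in _ <= X * _ * _](_ : _ = n%:R * (nrm (g x) + nrm (f x) + a * b) + 1) //.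
have : 0 <= e / c * nrm h by rewrite mulr_ge0 ?nrm_ge0 // ltW.
by set t := n%:R; set s := e / c; nra.
Qed.

Lemma is_derive_chain W (f : Cplx R -> W) (g : Cplx R -> Cplx R)
    (x dg : Cplx R) (df : W) :
  is_derive x 1 g dg -> is_derive (g x) 1 f df ->
  is_derive x 1 (fun y => f (g y)) (dg *: df).
Proof.
move=> Hg Hf; apply/is_derive_nrmP => e e0.
have [d1 d10 L1] := is_derive_lip Hg.
pose b := nrm dg + 1; have b0 : 0 < b by rewrite ltr_wpDl ?nrm_ge0.
have e1 : 0 < e / 2 / b by rewrite !divr_gt0.
have e2 : 0 < e / 2 / (nrm df + 1) by rewrite !divr_gt0 // ltr_wpDl ?nrm_ge0.
move/is_derive_nrmP: Hg => /(_ _ e2)[d2 d20 H2].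
move/is_derive_nrmP: Hf => /(_ _ e1)[d3 d30 H3].
exists (Num.min (Num.min d1 d2) (d3 / b)); first by rewrite !lt_min d10 d20 divr_gt0.
move=> h; rewrite !le_min => /andP[/andP[h1 h2] h3].
have {}L1 := L1 h h1; have {}H2 := H2 h h2.
set k := g (x + h *: 1) - g x in L1 H2 *.
have kd : nrm k <= d3.
  by apply: le_trans L1 _; rewrite mulrC -ler_pdivlMr.
have := H3 k kd; rewrite [k *: 1]mulr1 -[g x + k]addrC subrK => {}H3.
rewrite -[f _ - _](subrK (k *: df)) -addrA scalerA -scalerBl.
apply: le_trans (ler_nrmD _ _) _; rewrite nrmZ.
apply: (@le_trans _ _ (e / 2 / b * (b * nrm h) +
   e / 2 / (nrm df + 1) * nrm h * (nrm df + 1))).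
  apply: lerD.
    by apply: le_trans H3 _; rewrite ler_wpM2l // ltW.
  apply: ler_pM; [exact: nrm_ge0|exact: nrm_ge0|exact: H2|].
  by rewrite lerDl.
rewrite le_eqVlt; apply/orP; left; apply/eqP; field.
by rewrite !gt_eqF // ltr_wpDl ?nrm_ge0.
Qed.

Lemma is_derive_mxP V m n (f : V -> 'M[Cplx R]_(m, n)) (x v : V) df :
  is_derive x v f df <->
  forall i j, is_derive x v (fun y => f y i j : Cplx R) (df i j).
Proof.
split=> [/is_derive_nrmP H i j|H]; apply/is_derive_nrmP => e e0.
  have [d d0 Hd] := H e e0; exists d => // h hd.
  by apply: le_trans (Hd h hd); have := nrm_mxE (f (x + h *: v) - f x - h *: df) i j;
     rewrite !mxE.
have /choice[d Hd] : forall ij : 'I_m * 'I_n, exists d : R, 0 < d /\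
   forall h : Cplx R, nrm h <= d ->
   nrm (f (x + h *: v) ij.1 ij.2 - f x ij.1 ij.2 - h *: df ij.1 ij.2) <= e * nrm h.
  move=> [i j]; move/is_derive_nrmP: (H i j) => /(_ e e0)[d d0 Hd].
  by exists d; split.
exists (\big[Num.min/1]_ij d ij).
  by apply/bigmin_gtP; split=> // ij _; case: (Hd ij).
move=> h /bigmin_geP[_ hd]; apply/nrm_mxP; first by rewrite mulr_ge0 ?nrm_ge0 ?ltW.
move=> i j; rewrite !mxE; case: (Hd (i, j)) => _; apply; exact: hd.
Qed.

Lemma is_derive_partial1 W (F : Cplx R * Cplx R -> W) (u v : Cplx R) (L : W) :
  is_derive (u, v) (1, 0) F L <-> is_derive u 1 (fun s => F (s, v)) L.
Proof.
have E (h : Cplx R) : (u, v) + h *: (1, 0) = (u + h *: 1, v).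
  by congr (_, _); rewrite /= scaler0 addr0.
by split=> /is_derive_nrmP H; apply/is_derive_nrmP => e e0;
  have [d d0 Hd] := H e e0; exists d => // h hd; have := Hd h hd; rewrite E.
Qed.

Lemma is_derive_partial2 W (F : Cplx R * Cplx R -> W) (u v : Cplx R) (L : W) :
  is_derive (u, v) (0, 1) F L <-> is_derive v 1 (fun s => F (u, s)) L.
Proof.
have E (h : Cplx R) : (u, v) + h *: (0, 1) = (u, v + h *: 1).
  by congr (_, _); rewrite /= scaler0 addr0.
by split=> /is_derive_nrmP H; apply/is_derive_nrmP => e e0;
  have [d d0 Hd] := H e e0; exists d => // h hd; have := Hd h hd; rewrite E.
Qed.

Lemma is_deriveZl W (f : Cplx R -> Cplx R) (w : W) (x df : Cplx R) :
  is_derive x 1 f df -> is_derive x 1 (fun y => f y *: w) (df *: w).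
Proof.
move=> Hf.
have Hw : is_derive (f x) 1 (fun y : Cplx R => y *: w) w.
  apply/is_derive_nrmP => e e0; exists 1 => // h _.
  rewrite -!scalerBl [h *: 1]mulr1 addrAC addrK.
  by rewrite subrr scale0r nrm0 mulr_ge0 ?nrm_ge0 ?ltW.
exact: is_derive_chain Hf Hw.
Qed.

End Derivative.

(** * Mean value inequality, Gronwall estimate, uniqueness for linear equations *)

Section MeanValue.
Variables (R : realType).

Definition seg (a b : Cplx R) (t : R) : Cplx R := a + t%:C * (b - a).

Lemma seg0 a b : seg a b 0 = a.
Proof. by rewrite /seg mul0r addr0. Qed.

Lemma seg1 a b : seg a b 1 = b.
Proof. by rewrite /seg mul1r addrC subrK. Qed.

Lemma seg_seg a b s t : seg a (seg a b s) t = seg a b (t * s).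
Proof. by rewrite /seg [a + s%:C * _]addrC addrK mulrA -rmorphM. Qed.

Lemma seg_segr a b s t : seg (seg a b s) b t = seg a b (s + t * (1 - s)).
Proof. by rewrite /seg rmorphD rmorphM rmorphB rmorph1 /=; ring. Qed.

Lemma is_derive_real (phi : R -> R) (t L : R) :
  (forall e : R, 0 < e -> exists2 d : R, 0 < d & forall h : R,
    `|h| <= d -> `|phi (t + h) - phi t - h * L| <= e * `|h|) ->
  is_derive t 1 phi L.
Proof.
move=> H.
suff HL : h^-1 *: ((phi \o shift t) (h *: 1) - phi t) @[h --> 0^'] --> L.
  by split; [apply/cvg_ex; exists L|exact/cvg_lim].
apply/cvgrPdist_le => e e0.
have [d d0 Hd] := H e e0; exists d => //.
move=> h /=; rewrite sub0r normrN => hd h0.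
have nh : 0 < `|h| by rewrite normr_gt0.
rewrite distrC -(ler_pM2r nh) -normrM mulrBl.
have := Hd h (ltW hd); rewrite [h *: 1]mulr1 [t + h]addrC.
by congr (`| _ | <= _); rewrite [L * h]mulrC; congr (_ - _); rewrite mulrC mulVKf.
Qed.

Lemma seg_derive (f : Cplx R -> Cplx R) (a b w : Cplx R) df t :
  is_derive (seg a b t) 1 f df ->
  is_derive t 1 (fun s => complex.Re (w * f (seg a b s)))
    (complex.Re (w * (b - a) * df)).
Proof.
move=> /is_derive_nrmP H; apply: is_derive_real => e e0.
pose c := nrm w * nrm (b - a) + 1.
have c0 : 0 < c by rewrite ltr_wpDl // mulr_ge0 ?nrm_ge0.
have [d d0 Hd] := H (e / c) (divr_gt0 e0 c0).
have c1 : 0 < nrm (b - a) + 1 by rewrite ltr_wpDl ?nrm_ge0.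
exists (d / (nrm (b - a) + 1)); first by rewrite divr_gt0.
move=> h hd.
have := Hd (h%:C * (b - a)); rewrite nrmM nrm_real.
have hd' : `|h| * nrm (b - a) <= d.
  rewrite ler_pdivlMr // in hd; apply: le_trans hd.
  by rewrite ler_wpM2l // lerDl.
move=> /(_ hd'); rewrite [_ *: 1]mulr1.
have -> : seg a b t + h%:C * (b - a) = seg a b (t + h).
  by rewrite /seg rmorphD /= mulrDl addrA.
move=> K.
have -> : complex.Re (w * f (seg a b (t + h))) - complex.Re (w * f (seg a b t))
   - h * complex.Re (w * (b - a) * df)
  = complex.Re (w * (f (seg a b (t + h)) - f (seg a b t) - (h%:C * (b - a)) * df)).
  move: (b - a) => D; rewrite !mulrBr.
  have -> : w * (h%:C * D * df) = h%:C * (w * D * df) by ring.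
  move: (w * f _) (w * f _) (w * _ * df) => [x1 x2] [x3 x4] [x5 x6] /=.
  by rewrite mul0r subr0.
apply: le_trans (nrm_Re _) _; rewrite nrmM.
apply: (@le_trans _ _ (nrm w * (e / c * (`|h| * nrm (b - a))))).
  by rewrite ler_wpM2l ?nrm_ge0.
have -> : e * `|h| = c * (e / c * `|h|) by field; rewrite gt_eqF.
have -> : nrm w * (e / c * (`|h| * nrm (b - a))) =
  (nrm w * nrm (b - a)) * (e / c * `|h|) by ring.
rewrite ler_wpM2r // ?lerDl // mulr_ge0 // ltW // divr_gt0 //.
Qed.

(** The mean value theorem with equality fails for complex values. A factor [w] of modulus 1 rotates
    the increment onto the positive real axis, and the real theorem is applied to the real part of w
    f along the segment. *)
Lemma mean_value_scalar (f df : Cplx R -> Cplx R) (a b : Cplx R) (L : R) :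
  (forall t : R, 0 <= t <= 1 -> is_derive (seg a b t) 1 f (df (seg a b t)) /\
     nrm (df (seg a b t)) <= L) ->
  nrm (f b - f a) <= L * nrm (b - a).
Proof.
move=> H; set D := f b - f a.
have L0 : 0 <= L.
  by apply: le_trans (nrm_ge0 (df (seg a b 0))) _; case: (H 0) => //; rewrite lexx ler01.
have [->|D0] := eqVneq D 0; first by rewrite nrm0 mulr_ge0 ?nrm_ge0.
have [w nw wD] : exists2 w : Cplx R, nrm w = 1 & w * D = (nrm D)%:C.
  exists (`|D| / D); last by rewrite divfK // normrC.
  rewrite nrmM nrmV normrC nrm_real ger0_norm ?nrm_ge0 // divff //.
  by apply: contra_neq D0; exact: nrm0_eq0.
pose phi s := complex.Re (w * f (seg a b s)).
have Hd (t : R) : 0 <= t <= 1 -> is_derive t 1 phi (complex.Re (w * (b - a) * df (seg a b t))).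
  by move=> /H[Hf _]; exact: seg_derive.
have [|||c] := @MVT_segment _ phi (fun t => complex.Re (w * (b - a) * df (seg a b t))) 0 1.
- exact: ler01.
- by move=> x; rewrite in_itv /= => /andP[/ltW x0 /ltW x1]; apply: Hd; rewrite x0.
- apply: derivable_within_continuous => x; rewrite in_itv /= => x01.
  by have [] := Hd x x01.
rewrite in_itv /= => c01; rewrite subr0 mulr1 /phi seg0 seg1 => E.
have -> : nrm D = complex.Re (w * f b) - complex.Re (w * f a).
  have -> : complex.Re (w * f b) - complex.Re (w * f a) = complex.Re (w * D).
    rewrite /D mulrBr; by move: (w * f b) (w * f a) => [? ?] [? ?].
  by rewrite wD.
rewrite E; apply: le_trans (ler_norm _) _; apply: le_trans (nrm_Re _) _.
rewrite !nrmM nw mul1r mulrC ler_wpM2r ?nrm_ge0 //.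
by case: (H c c01).
Qed.

Lemma mean_value m n (f df : Cplx R -> 'M[Cplx R]_(m, n)) (a b : Cplx R) (L : R) :
  (forall t : R, 0 <= t <= 1 -> is_derive (seg a b t) 1 f (df (seg a b t)) /\
     nrm (df (seg a b t)) <= L) ->
  nrm (f b - f a) <= L * nrm (b - a).
Proof.
move=> H.
have L0 : 0 <= L.
  by apply: le_trans (nrm_ge0 (df (seg a b 0))) _; case: (H 0) => //; rewrite lexx ler01.
apply/nrm_mxP => [|i j]; first by rewrite mulr_ge0 ?nrm_ge0.
rewrite !mxE; apply: (@mean_value_scalar (fun z => f z i j) (fun z => df z i j)) => t /H[].
move=> /is_derive_mxP/(_ i j) Hf Hb; split=> //.
by apply: le_trans Hb; exact: nrm_mxE.
Qed.

Lemma is_derive0_const m n (f : Cplx R -> 'M[Cplx R]_(m, n)) (a b : Cplx R) :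
  (forall t : R, 0 <= t <= 1 -> is_derive (seg a b t) 1 f 0) -> f b = f a.
Proof.
move=> H; apply/eqP; rewrite -subr_eq0; apply/eqP/nrm_small_eq0 => e e0.
have := @mean_value _ _ f (fun=> 0) a b 0.
rewrite mul0r => K; apply: le_trans (K _) (ltW e0) => t t01.
by split; [exact: H|rewrite nrm0].
Qed.

Lemma seg_itvM (s t : R) : 0 <= s <= 1 -> 0 <= t <= 1 -> 0 <= s * t <= 1.
Proof. by move=> /andP[s0 s1] /andP[t0 t1]; rewrite mulr_ge0 //= mulr_ile1. Qed.

Lemma seg_nrm_continuous m n (f df : Cplx R -> 'M[Cplx R]_(m, n)) a b :
  (forall t : R, 0 <= t <= 1 -> is_derive (seg a b t) 1 f (df (seg a b t))) ->
  {within `[0, 1], continuous (fun t : R => nrm (f (seg a b t)))}.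
Proof.
move=> H.
apply: continuous_in_subspaceT => t.
rewrite inE /= in_itv /= => /H/is_derive_lip[d d0 Hd].
set l := nrm (df _) + 1 in Hd.
have l0 : 0 < l by rewrite ltr_wpDl ?nrm_ge0.
have c0 : 0 < nrm (b - a) + 1 by rewrite ltr_wpDl ?nrm_ge0.
apply/cvgrPdist_le => e e0.
near=> s.
have Hs : `|s - t| * (nrm (b - a) + 1) <= Num.min d (e / l).
  rewrite -ler_pdivlMr //; near: s.
  apply/nbhs_ballP; exists (Num.min d (e / l) / (nrm (b - a) + 1)) => /=.
    by rewrite divr_gt0 // lt_min d0 divr_gt0.
  by move=> s /=; rewrite distrC => /ltW.
have Hs' : nrm (seg a b s - seg a b t) <= Num.min d (e / l).
  apply: le_trans Hs; rewrite /seg opprD addrACA subrr add0r -mulrBl.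
  by rewrite -rmorphB nrmM nrm_real ler_wpM2l // lerDl.
have := Hd (seg a b s - seg a b t).
move: Hs'; rewrite le_min => /andP[Hs1 Hs2] /(_ Hs1).
rewrite [_ *: 1]mulr1 [seg a b t + _]addrC subrK => H1.
have {H1} H1 : nrm (f (seg a b s) - f (seg a b t)) <= e.
  apply: le_trans H1 _; rewrite mulrC -ler_pdivlMr //.
rewrite ler_norml; apply/andP; split.
  rewrite lerBrDr addrC -lerBrDr opprK; apply: le_trans _ (lerD (lexx _) H1).
  by rewrite -{1}[f (seg a b s)](subrK (f (seg a b t))) addrC; exact: ler_nrmD.
rewrite lerBlDr; apply: le_trans _ (lerD H1 (lexx _)); rewrite nrmB.
by rewrite -{1}[f (seg a b t)](subrK (f (seg a b s))); exact: ler_nrmD.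
Unshelve. all: by end_near.
Qed.

Lemma seg_bounded m n (f df : Cplx R -> 'M[Cplx R]_(m, n)) a b :
  (forall t : R, 0 <= t <= 1 -> is_derive (seg a b t) 1 f (df (seg a b t))) ->
  exists2 K : R, 0 <= K & forall t : R, 0 <= t <= 1 -> nrm (f (seg a b t)) <= K.
Proof.
move=> /seg_nrm_continuous/(EVT_max (@ler01 R))[c _ Hc].
exists (nrm (f (seg a b c))); first exact: nrm_ge0.
by move=> t t01; apply: Hc; rewrite in_itv.
Qed.

(** If K |b - a| <= 1/2, the maximum of the norm of f exceeds its initial value by at most half of
    itself, so it is at most twice that value. A longer segment is cut into such pieces, each
    costing a factor 2. *)
Lemma gronwall m n (f df : Cplx R -> 'M[Cplx R]_(m, n)) (K : R) k a b :
  0 <= K -> K * nrm (b - a) <= k%:R / 2 ->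
  (forall t : R, 0 <= t <= 1 -> is_derive (seg a b t) 1 f (df (seg a b t)) /\
     nrm (df (seg a b t)) <= K * nrm (f (seg a b t))) ->
  nrm (f b) <= 2 ^+ k.+1 * nrm (f a).
Proof.
move=> K0.
have base a' b' : K * nrm (b' - a') <= 1 / 2 ->
  (forall t : R, 0 <= t <= 1 -> is_derive (seg a' b' t) 1 f (df (seg a' b' t)) /\
     nrm (df (seg a' b' t)) <= K * nrm (f (seg a' b' t))) ->
  nrm (f b') <= 2 * nrm (f a').
  move=> Kab H.
  pose phi t := nrm (f (seg a' b' t)).
  have phic : {within `[0, 1], continuous phi}.
    by apply: (@seg_nrm_continuous _ _ f df) => t /H[].
  have [c c01 Hc] := EVT_max (@ler01 R) phic.
  move: c01; rewrite in_itv /= => c01.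
  have := @mean_value _ _ f df a' (seg a' b' c) (K * phi c).
  have Hseg (t : R) : 0 <= t <= 1 -> is_derive (seg a' (seg a' b' c) t) 1 f
      (df (seg a' (seg a' b' c) t)) /\
      nrm (df (seg a' (seg a' b' c) t)) <= K * phi c.
    move=> t01; rewrite seg_seg; have tc := seg_itvM t01 c01.
    have [Hf Hb] := H _ tc; split=> //.
    by apply: le_trans Hb _; rewrite ler_wpM2l // Hc // in_itv.
  move=> /(_ Hseg) {Hseg}.
  rewrite {2}/seg [a' + _]addrC addrK nrmM nrm_real => M.
  have {M} : phi c - nrm (f a') <= phi c / 2.
    rewrite lerBlDr.
    apply: (@le_trans _ _ (nrm (f (seg a' b' c) - f a') + nrm (f a'))).
      by rewrite /phi -{1}[f (seg a' b' c)](subrK (f a')); exact: ler_nrmD.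
    rewrite lerD2r; apply: le_trans M _.
    have /andP[c0 c1] := c01; rewrite ger0_norm //.
    rewrite (_ : K * phi c * _ = phi c * (c * (K * nrm (b' - a')))); last by ring.
    rewrite ler_wpM2l ?nrm_ge0 // -[_^-1]mul1r; apply: le_trans Kab.
    by rewrite -[X in _ <= X]mul1r ler_wpM2r // mulr_ge0 ?nrm_ge0.
  have : nrm (f b') <= phi c.
    by rewrite -{1}(seg1 a' b'); apply: Hc; rewrite in_itv /= ler01 lexx.
  lra.
(* At k = 0 the doubling estimate is still used once, which explains the exponent k + 1. *)
elim: k b => [|k IH] b Kab H.
  rewrite expr1; apply: base => //; apply: le_trans Kab _.
  by rewrite mul0r divr_ge0.
(* Cutting at k / (k + 1) leaves a first part within the bound k / 2 and a last part within 1 /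
   2. *)
pose s : R := k%:R / k.+1%:R.
have k0 : 0 < k.+1%:R :> R by rewrite ltr0n.
have s0 : 0 <= s by rewrite divr_ge0.
have s1 : s <= 1 by rewrite ler_pdivrMr // mul1r ler_nat.
have Es : s * k.+1%:R = k%:R by rewrite divfK // gt_eqF.
rewrite [2 ^+ _]exprS -mulrA.
apply: (@le_trans _ _ (2 * nrm (f (seg a b s)))); last first.
  rewrite ler_wpM2l //; apply: IH.
    rewrite {1}/seg [a + _]addrC addrK nrmM nrm_real ger0_norm // mulrCA.
    by apply: le_trans (ler_wpM2l s0 Kab) _; rewrite mulrA Es.
  move=> t t01; rewrite seg_seg; apply: H; apply: seg_itvM => //.
  by rewrite s0.
apply: base.
  have -> : b - seg a b s = (1 - s)%:C * (b - a).
    by rewrite /seg rmorphB rmorph1 /=; ring.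
  have s1' : 0 <= 1 - s by rewrite subr_ge0.
  rewrite nrmM nrm_real ger0_norm // mulrCA.
  apply: le_trans (ler_wpM2l s1' Kab) _.
  rewrite mulrA (_ : (1 - s) * k.+1%:R = 1) //.
  by rewrite mulrBl Es mul1r -natr1 [k%:R + 1]addrC addrK.
move=> t t01; rewrite seg_segr; apply: H.
by have /andP[t0 t1] := t01; apply/andP; split; nra.
Qed.

(** The Gronwall factor is finite, the number of half-steps being an archimedean bound for 2 K |b -
    a|, and it multiplies a zero initial value. *)
Lemma linear_ode_eq0 m n (f df : Cplx R -> 'M[Cplx R]_(m, n)) (K : R) a b :
  0 <= K -> f a = 0 ->
  (forall t : R, 0 <= t <= 1 -> is_derive (seg a b t) 1 f (df (seg a b t)) /\
     nrm (df (seg a b t)) <= K * nrm (f (seg a b t))) ->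
  f b = 0.
Proof.
move=> K0 fa H; pose x := 2 * (K * nrm (b - a)).
have x0 : 0 <= x by rewrite !mulr_ge0 // nrm_ge0.
have := @gronwall _ _ f df K (Num.bound x) a b K0 _ H.
rewrite fa nrm0 mulr0 => G; apply: nrm0_eq0; apply/eqP; rewrite eq_le nrm_ge0 andbT.
by apply: G; have := ltW (archi_boundP x0); rewrite /x; lra.
Qed.

End MeanValue.

(** * Limits, comparison of series, differentiation of power series *)

Section Limits.
Variables (R : realType).

Lemma cvg_nrm_le (V : normedModType (Cplx R)) (u : nat -> V) (l : V) (B : R) N :
  u @ \oo --> l -> (forall k, (N <= k)%N -> nrm (u k) <= B) -> nrm l <= B.
Proof.
move=> /cvg_nrmP ul uB; apply/ler_addgt0Pl => e e0.
have [N' HN'] := ul e e0; rewrite -(subrK (u (maxn N N')) l).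
apply: le_trans (ler_nrmD _ _) _; apply: lerD; last by rewrite uB // leq_maxl.
by rewrite nrmB HN' // leq_maxr.
Qed.

Lemma cvg_subZ (V : normedModType (Cplx R)) (u v w : nat -> V) (l m p : V)
    (h : Cplx R) : u @ \oo --> l -> v @ \oo --> m -> w @ \oo --> p ->
  (fun k => u k - v k - h *: w k) @ \oo --> l - m - h *: p.
Proof. by move=> ul vm wp; apply: cvgB; [exact: cvgB|exact: cvgZr]. Qed.

Lemma cvg_mulmx m n p (A : 'M[Cplx R]_(m, n)) (u : nat -> 'M[Cplx R]_(n, p))
    (l : 'M[Cplx R]_(n, p)) :
  u @ \oo --> l -> (fun k => A *m u k) @ \oo --> A *m l.
Proof.
move=> /cvg_nrmP ul; apply/cvg_nrmP => e e0.
pose c := n%:R * nrm A + 1; have c0 : 0 < c by rewrite ltr_wpDl // mulr_ge0 ?nrm_ge0.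
have [N HN] := ul (e / c) (divr_gt0 e0 c0); exists N => k /HN H.
rewrite -mulmxBr; apply: le_trans (nrm_mulmx _ _) _; rewrite mulrA.
apply: (@le_trans _ _ (c * (e / c))); last by rewrite mulrC divfK ?gt_eqF.
by rewrite ler_pM ?nrm_ge0 ?mulr_ge0 ?nrm_ge0 // lerDl.
Qed.

Lemma cvg_mulmxr m n p (A : 'M[Cplx R]_(n, p)) (u : nat -> 'M[Cplx R]_(m, n))
    (l : 'M[Cplx R]_(m, n)) :
  u @ \oo --> l -> (fun k => u k *m A) @ \oo --> l *m A.
Proof.
move=> /cvg_nrmP ul; apply/cvg_nrmP => e e0.
pose c := n%:R * nrm A + 1; have c0 : 0 < c by rewrite ltr_wpDl // mulr_ge0 ?nrm_ge0.
have [N HN] := ul (e / c) (divr_gt0 e0 c0); exists N => k /HN H.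
rewrite -mulmxBl; apply: le_trans (nrm_mulmx _ _) _; rewrite mulrCA mulrC.
apply: (@le_trans _ _ (c * (e / c))); last by rewrite mulrC divfK ?gt_eqF.
by rewrite ler_pM ?nrm_ge0 ?mulr_ge0 ?nrm_ge0 // lerDl.
Qed.

Lemma cvg_mxP m n (u : nat -> 'M[Cplx R]_(m, n))
    (l : 'M[Cplx R]_(m, n)) :
  (forall i j, (fun k => u k i j) @ \oo --> (l i j : Cplx R)) -> u @ \oo --> l.
Proof.
move=> H; apply/cvg_nrmP => e e0.
have /choice[N HN] : forall ij : 'I_m * 'I_n, exists N, forall k, (N <= k)%N ->
    nrm (u k ij.1 ij.2 - l ij.1 ij.2 : Cplx R) <= e.
  by move=> [i j]; move/cvg_nrmP: (H i j) => /(_ e e0).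
exists (\max_ij N ij)%N => k /bigmax_leqP Hk; apply/nrm_mxP; first exact: ltW.
by move=> i j; rewrite !mxE; apply: (HN (i, j)); exact: Hk.
Qed.

(** Real and imaginary parts are each dominated by [b], so the real comparison test applies to
    both. *)
Lemma cvg_series_nrm (a : nat -> Cplx R) (b : nat -> R) :
  (forall k, nrm (a k) <= b k) -> cvgn (series b) -> cvgn (series a).
Proof.
move=> ab cb.
have sub (c : nat -> R) : (forall k, `|c k| <= nrm (a k)) -> cvgn (series c).
  move=> Hc; apply: normed_cvg; apply: series_le_cvg cb => k //=.
  - by apply: le_trans (ab k); exact: nrm_ge0.
  - exact: le_trans (Hc k) (ab k).
have cR := sub (fun k => complex.Re (a k)) (fun k => nrm_Re (a k)).
have cI := sub (fun k => complex.Im (a k)) (fun k => nrm_Im (a k)).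
apply/cvg_ex.
exists ((limn (series (fun k => complex.Re (a k))))
   +i* (limn (series (fun k => complex.Im (a k)))))%C.
apply/cvg_nrmP => e e0; have e2 : 0 < e / 2 by rewrite divr_gt0.
move/cvgrPdist_le: cR => /(_ _ e2)[N1 _ H1].
move/cvgrPdist_le: cI => /(_ _ e2)[N2 _ H2].
exists (maxn N1 N2) => k; rewrite geq_max => /andP[k1 k2].
have {}H1 := H1 k k1; have {}H2 := H2 k k2.
apply: le_trans (nrm_ReIm _) _; rewrite (splitr e).
have E : series a k = (series (fun k => complex.Re (a k)) k +i*
    series (fun k => complex.Im (a k)) k)%C.
  rewrite /series /=; elim: k {k1 k2 H1 H2} => [|k IH]; first by rewrite !big_geq.
  by rewrite !big_nat_recr //= IH; case: (a k).
by rewrite E; apply: lerD; rewrite /= distrC.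
Qed.

Lemma normrn_le n : nrm (1%:M : 'M[Cplx R]_n) <= 1.
Proof.
apply/nrm_mxP => // i j; rewrite mxE; case: eqP => _ /=; first by rewrite nrm1.
by rewrite nrm0.
Qed.

Lemma nrm_expmx n (A : 'M[Cplx R]_n) k : nrm (A ^+ k) <= (n%:R * nrm A) ^+ k.
Proof.
elim: k => [|k IH]; first by rewrite !expr0; exact: normrn_le.
rewrite !exprS; apply: le_trans (nrm_mulmx _ _) _.
by rewrite mulrA ler_wpM2l // mulr_ge0 ?nrm_ge0.
Qed.

Lemma exprZmx n (z : Cplx R) (A : 'M[Cplx R]_n) k : (z *: A) ^+ k = z ^+ k *: A ^+ k.
Proof.
elim: k => [|k IH]; first by rewrite !expr0 scale1r.
rewrite !exprS IH.
change ((z *: A) *m (z ^+ k *: A ^+ k) = (z * z ^+ k) *: (A *m A ^+ k)).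
by rewrite -scalemxAl -scalemxAr scalerA.
Qed.

Lemma series_exp_le (x : R) N : 0 <= x -> series (exp_coeff x) N <= expR x.
Proof.
move=> x0; apply: nondecreasing_cvgn_le; last exact: is_cvg_series_exp_coeff.
apply/nondecreasing_seqP => k; rewrite /series /= big_nat_recr //= lerDl.
exact: exp_coeff_ge0.
Qed.

(** The base |z| + 2 closes the induction: |z| + 1 bounds z + h, and the remaining power of |z| + 2
    absorbs the term h^2 (k + 1) z^k. *)
Lemma derive_pow_rem (z h : Cplx R) k : nrm h <= 1 ->
  nrm ((z + h) ^+ k.+1 - z ^+ k.+1 - h * (k.+1%:R * z ^+ k)) <=
  nrm h ^+ 2 * (nrm z + 2) ^+ k.+1.
Proof.
move=> h1; set x := nrm z; have x0 : 0 <= x by exact: nrm_ge0.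
have pow j : j.+1%:R * x ^+ j <= (x + 1) ^+ j.+1.
  elim: j => [|j IH]; first by rewrite mul1r expr0 expr1 lerDr.
  rewrite exprS [(x + 1) ^+ _]exprS -natr1 mulrDl mul1r.
  apply: (@le_trans _ _ (x * (x + 1) ^+ j.+1 + (x + 1) ^+ j.+1)).
    apply: lerD; first by rewrite mulrCA ler_wpM2l.
    by rewrite -exprS lerXn2r ?nnegrE ?addr_ge0 // lerDl.
  by rewrite mulrDl mul1r.
elim: k => [|k IH].
  rewrite !expr1 expr0 mulr1 mulr1 addrAC addrK subrr nrm0.
  by rewrite mulr_ge0 // ?sqr_ge0 // addr_ge0.
set d := _ - _ - _ in IH.
have -> : (z + h) ^+ k.+2 - z ^+ k.+2 - h * (k.+2%:R * z ^+ k.+1) =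
  (z + h) * d + h ^+ 2 * (k.+1%:R * z ^+ k).
  by rewrite /d [(z + h) ^+ k.+2]exprS [z ^+ k.+2]exprS [z ^+ k.+1]exprS -natr1; ring.
apply: le_trans (ler_nrmD _ _) _; rewrite !nrmM !nrmX nrm_natr -/x.
apply: (@le_trans _ _ ((x + 1) * (nrm h ^+ 2 * (x + 2) ^+ k.+1) +
   nrm h ^+ 2 * (x + 2) ^+ k.+1)).
  apply: lerD.
    rewrite ler_pM ?nrm_ge0 //.
    by apply: le_trans (ler_nrmD _ _) _; rewrite lerD2l.
  rewrite ler_wpM2l ?sqr_ge0 //; apply: le_trans (pow k) _.
  by rewrite lerXn2r ?nnegrE ?addr_ge0 // lerD2l ler1n.
by rewrite [(x + 2) ^+ k.+2]exprS le_eqVlt; apply/orP; left; apply/eqP; ring.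
Qed.

(** The second-order remainders of the powers sum to |h|^2 times a convergent exponential series.
    Coefficients in any normed space let one statement serve both the scalar and the matrix
    exponential. *)
Lemma is_derive_pseries (V : normedModType (Cplx R)) (a : nat -> V) (c C : R)
    (f g : Cplx R -> V) (z : Cplx R) :
  0 <= c -> 0 <= C -> (forall k, nrm (a k) <= c * (C ^+ k / k`!%:R)) ->
  (forall w, series (fun k => w ^+ k *: a k) @ \oo --> f w) ->
  (forall w, series (fun k => w ^+ k *: (k.+1%:R *: a k.+1)) @ \oo --> g w) ->
  is_derive z 1 f (g z).
Proof.
move=> c0 C0 Ha Hf Hg.
pose x := nrm z + 2; have x0 : 0 <= x by rewrite addr_ge0 ?nrm_ge0.
pose B := c * expR (x * C).
have B0 : 0 <= B by rewrite mulr_ge0 // expR_ge0.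
have key (h : Cplx R) : nrm h <= 1 ->
    nrm (f (z + h) - f z - h *: g z) <= nrm h ^+ 2 * B.
  move=> h1; pose S w := series (fun k => w ^+ k *: a k).
  pose G w := series (fun k => w ^+ k *: (k.+1%:R *: a k.+1)).
  (* The derived series has lost the constant term, hence its partial sums are one step shorter. *)
  have cv : (fun N => S (z + h) N.+1 - S z N.+1 - h *: G z N) @ \oo -->
      f (z + h) - f z - h *: g z.
    by apply: cvg_subZ (Hg z); rewrite (cvg_shiftS (S _)); exact: Hf.
  apply: (cvg_nrm_le (N := 0) cv) => N _.
  have -> : S (z + h) N.+1 - S z N.+1 - h *: G z N = \sum_(0 <= k < N)
      ((z + h) ^+ k.+1 - z ^+ k.+1 - h * (k.+1%:R * z ^+ k)) *: a k.+1.
    rewrite /S /G /series /= !big_nat_recl // !expr0 scale1r.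
    rewrite opprD addrACA subrr add0r scaler_sumr -!sumrB.
    apply: eq_bigr => k _; rewrite !scalerBl -!scalerA.
    by congr (_ - _ *: _); rewrite !scalerA mulrC.
  apply: (@le_trans _ _ (\sum_(0 <= k < N) nrm h ^+ 2 * (c * exp_coeff (x * C) k.+1))).
    apply: le_trans (ler_nrm_sum _ _ _) _; apply: ler_sum => k _.
    rewrite nrmZ; apply: le_trans (ler_pM (nrm_ge0 _) (nrm_ge0 _) (derive_pow_rem z k h1) (Ha k.+1)) _.
    rewrite /exp_coeff /= exprMn -/x le_eqVlt; apply/orP; left; apply/eqP.
    by move: (k.+1`!%:R^-1) (x ^+ _) (C ^+ _) => t1 t2 t3; ring.
  rewrite -mulr_sumr ler_wpM2l ?sqr_ge0 // -mulr_sumr ler_wpM2l //.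
  have := @series_exp_le (x * C) N.+1 (mulr_ge0 x0 C0).
  apply: le_trans; rewrite /series /= [leRHS]big_nat_recl // lerDr.
  exact: exp_coeff_ge0 (mulr_ge0 x0 C0).
apply/is_derive_nrmP => e e0.
have B1 : 0 < B + 1 by rewrite ltr_wpDl.
exists (Num.min 1 (e / (B + 1))); first by rewrite lt_min ltr01 divr_gt0.
move=> h; rewrite le_min [h *: 1]mulr1 => /andP[h1 h2].
apply: le_trans (key h h1) _; rewrite expr2 -mulrA mulrC ler_wpM2r ?nrm_ge0 //.
rewrite ler_pdivlMr // in h2; apply: le_trans h2.
by rewrite ler_wpM2l ?nrm_ge0 // lerDl.
Qed.

End Limits.

(** * The matrix exponential *)

Section MatrixExponential.
Variables (R : realType) (n : nat).
Implicit Types A B M : 'M[Cplx R]_n.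

Lemma nrm_fact_inv k : nrm (k`!%:R^-1 : Cplx R) = (k`!%:R)^-1.
Proof. by rewrite nrmV nrm_natr. Qed.

Lemma nrm_mexp_coeff A k :
  nrm ((k`!%:R)^-1 *: A ^+ k) <= exp_coeff (n%:R * nrm A) k.
Proof.
rewrite nrmZ nrm_fact_inv /exp_coeff /= mulrC ler_wpM2r ?invr_ge0 //.
exact: nrm_expmx.
Qed.

Lemma cvg_mexp A :
  series (fun k => (k`!%:R)^-1 *: A ^+ k) @ \oo --> mexp A.
Proof.
rewrite /mexp; set u := fun k => _.
suff [l Hl] : exists l : 'M[Cplx R]_n, series u @ \oo --> l by exact: cvgP Hl.
have Hij i j : cvgn (series (fun k => u k i j)).
  apply: (@cvg_series_nrm _ _ (exp_coeff (n%:R * nrm A))).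
    move=> k; apply: le_trans (nrm_mexp_coeff A k).
    exact: (nrm_mxE (u k)).
  exact: is_cvg_series_exp_coeff.
exists (\matrix_(i, j) limn (series (fun k => u k i j))).
apply: cvg_mxP => i j; rewrite mxE.
rewrite (_ : (fun k => _) = series (fun k => u k i j)); first exact: Hij.
apply/funext => k; rewrite /series /= summxE //.
Qed.

Lemma mexp_uniq A (l : 'M[Cplx R]_n) : series (fun k => (k`!%:R)^-1 *: A ^+ k) @ \oo --> l ->
  mexp A = l.
Proof. by move=> H; exact/cvg_lim. Qed.

Lemma mexp_comm A B : A *m B = B *m A -> A *m mexp B = mexp B *m A.
Proof.
move=> AB; have H1 := cvg_mulmx (A := A) (cvg_mexp (A := B)); have H2 := cvg_mulmxr (A := A) (cvg_mexp (A := B)).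
suff E : (fun k => A *m series (fun k => (k`!%:R)^-1 *: B ^+ k) k) =
    (fun k => series (fun k => (k`!%:R)^-1 *: B ^+ k) k *m A).
  by rewrite E in H1; apply: cvg_unique H1 H2.
apply/funext => k; rewrite /series /= mulmx_sumr mulmx_suml.
apply: eq_bigr => i _; rewrite -scalemxAr -scalemxAl; congr (_ *: _).
elim: i => [|i IH]; first by rewrite !expr0; change (A *m 1%:M = 1%:M *m A); rewrite mulmx1 mul1mx.
rewrite exprS; change (A *m (B *m B ^+ i) = B *m B ^+ i *m A).
by rewrite mulmxA AB -mulmxA IH mulmxA.
Qed.

Lemma mexp0 : mexp (0 : 'M[Cplx R]_n) = 1%:M.
Proof.
apply: mexp_uniq; apply/cvg_nrmP => e e0; exists 1%N => -[//|k] _.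
rewrite /series /= big_nat_recl // expr0 fact0 invr1 scale1r big1 ?addr0 ?subrr ?nrm0 ?ltW //.
move=> i _; rewrite exprS; change ((i.+1`!%:R)^-1 *: (0 *m 0 ^+ i) = 0 :> 'M[Cplx R]_n).
by rewrite mul0mx scaler0.
Qed.

Lemma is_derive_mexp M (z : Cplx R) :
  is_derive z 1 (fun w => mexp (w *: M)) (M *m mexp (z *: M)).
Proof.
apply: (@is_derive_pseries _ _ (fun k => (k`!%:R)^-1 *: M ^+ k) 1 (n%:R * nrm M)
  _ (fun w => M *m mexp (w *: M))) => //.
- by rewrite mulr_ge0 ?nrm_ge0.
- by move=> k; rewrite mul1r; exact: nrm_mexp_coeff.
- move=> w; have := cvg_mexp (A := w *: M).
  rewrite (_ : series _ = series (fun k => w ^+ k *: ((k`!%:R)^-1 *: M ^+ k))) //.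
  congr series; apply/funext => k.
  by rewrite exprZmx !scalerA mulrC.
- move=> w; have := cvg_mulmx (A := M) (cvg_mexp (A := w *: M)).
  rewrite (_ : (fun k => M *m _) = series (fun k =>
    w ^+ k *: (k.+1%:R *: ((k.+1`!%:R)^-1 *: M ^+ k.+1)))) //.
  apply/funext => N; rewrite /series /= mulmx_sumr; apply: eq_bigr => k _.
  rewrite exprZmx !scalerA -scalemxAr exprS; change (M * M ^+ k) with (M *m M ^+ k).
  congr (_ *: _); rewrite factS natrM invfM mulrA -[RHS]mulrA mulrC; congr (_ * _).
  by rewrite mulVKf // pnatr_eq0.
Qed.

Lemma is_derive_mexpN M (z : Cplx R) :
  is_derive z 1 (fun w => mexp (- w *: M)) (- (M *m mexp (- z *: M))).
Proof.
apply: is_derive_eq.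
  apply: (@is_derive_chain _ _ (fun y => mexp (y *: M)) -%R).
  exact: is_derive_mexp.
by rewrite scaleN1r.
Qed.

Lemma mexp_commZ M (w : Cplx R) : M *m mexp (w *: M) = mexp (w *: M) *m M.
Proof. by apply: mexp_comm; rewrite -scalemxAr scalemxAl. Qed.

(** The product has derivative 0 and value 1 at the origin, which avoids multiplying two series. *)
Lemma mexp_mulV M (z : Cplx R) : mexp (z *: M) *m mexp (- z *: M) = 1%:M.
Proof.
have D (w : Cplx R) :
    is_derive w 1 (fun y => mexp (y *: M) *m mexp (- y *: M)) 0.
  apply: is_derive_eq.
    exact: is_derive_mulmx (is_derive_mexp M w) (is_derive_mexpN M w).
  by rewrite mulmxN mulmxA -mexp_commZ subrr.
have -> := is_derive0_const (a := 0) (b := z) (fun t _ => D (seg 0 z t)).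
by rewrite oppr0 scale0r mexp0 mulmx1.
Qed.

End MatrixExponential.

(** * The complex exponential and the half-planes over discs *)

Section ComplexExponential.
Variables (R : realType).
Implicit Types (z u v : Cplx R) (x : R).

Lemma nrm_cexp_coeff z k : nrm ((k`!%:R)^-1 * z ^+ k) = exp_coeff (nrm z) k.
Proof. by rewrite nrmM nrm_fact_inv nrmX /exp_coeff /= mulrC. Qed.

Lemma cvg_cexp z : series (fun k => (k`!%:R)^-1 * z ^+ k) @ \oo --> cexp z.
Proof.
have : cvgn (series (fun k => (k`!%:R)^-1 * z ^+ k)).
  apply: (@cvg_series_nrm _ _ (exp_coeff (nrm z))).
    by move=> k; rewrite nrm_cexp_coeff.
  exact: is_cvg_series_exp_coeff.
by [].
Qed.

Lemma cexp_uniq z (l : Cplx R) :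
  series (fun k => (k`!%:R)^-1 * z ^+ k) @ \oo --> l -> cexp z = l.
Proof. by move=> H; exact/cvg_lim. Qed.

#[local] Opaque cexp.

Lemma is_derive_cexp z : is_derive z 1 (@cexp R) (cexp z).
Proof.
apply: (@is_derive_pseries _ _ (fun k => (k`!%:R)^-1 : Cplx R) 1 1 _ (@cexp R)) => //.
- by move=> k; rewrite nrm_fact_inv expr1n !mul1r.
- move=> w; have := cvg_cexp (z := w).
  rewrite (_ : series _ = series (fun k => w ^+ k *: ((k`!%:R)^-1 : Cplx R))) //.
  by congr series; apply/funext => k; rewrite mulrC.
- move=> w; have := cvg_cexp (z := w).
  rewrite (_ : series _ = series (fun k =>
    w ^+ k *: (k.+1%:R *: ((k.+1`!%:R)^-1 : Cplx R)))) //.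
  congr series; apply/funext => k; rewrite mulrC; congr (_ * _).
  by rewrite factS natrM invfM [_ *: _]mulrA divff ?mul1r // pnatr_eq0.
Qed.

Lemma cexp0 : cexp (0 : Cplx R) = 1.
Proof.
apply: cexp_uniq; apply/cvg_nrmP => e e0; exists 1%N => -[//|k] _.
rewrite /series /= big_nat_recl // expr0 fact0 invr1 mulr1 big1 ?addr0 ?subrr ?nrm0 ?ltW //.
by move=> i _; rewrite exprS mul0r mulr0.
Qed.

Lemma is_derive0_const_scalar (f : Cplx R -> Cplx R) a b :
  (forall z, is_derive z 1 f 0) -> f b = f a.
Proof.
move=> H; apply/eqP; rewrite -subr_eq0; apply/eqP/nrm_small_eq0 => e e0.
have := @mean_value_scalar _ f (fun=> 0) a b 0.
rewrite mul0r => K; apply: le_trans (K _) (ltW e0) => t t01.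
by split; [exact: H|rewrite nrm0].
Qed.

(** The function e^z e^(u + v - z) has derivative 0; its values at z = 0 and z = u are the two
    sides. *)
Lemma cexpD u v : cexp (u + v) = cexp u * cexp v.
Proof.
pose f z := cexp z * cexp (u + v - z).
have D z : is_derive z 1 f 0.
  have Hg : is_derive z 1 (fun y => cexp (u + v - y)) (-1 *: cexp (u + v - z)).
    apply: (@is_derive_chain _ _ (@cexp R) (fun y => u + v - y)); last exact: is_derive_cexp.
    apply/is_derive_nrmP => e e0; exists 1 => // h _.
    rewrite [h *: 1]mulr1 [h *: -1]mulrN1 (_ : _ - _ - _ = 0).
      by rewrite nrm0 mulr_ge0 ?nrm_ge0 ?ltW.
    by ring.
  apply: is_derive_eq; first exact: (is_deriveM (is_derive_cexp z) Hg).
  pose a := cexp z; pose b := cexp (u + v - z).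
  by change (a * (-1 * b) + b * a = 0); ring.
have := is_derive0_const_scalar 0 u D.
by rewrite /f subr0 cexp0 mul1r [u + v]addrC addrK.
Qed.

Lemma cexp_neq0 z : cexp z != 0.
Proof.
apply/eqP => z0; have := cexpD z (- z); rewrite subrr cexp0 z0 mul0r.
by move/eqP; rewrite oner_eq0.
Qed.

Lemma cexp_conj z : cexp (z^*)%C = ((cexp z)^*)%C.
Proof.
apply: cexp_uniq; apply/cvg_nrmP => e e0.
have /cvg_nrmP/(_ e e0)[N HN] := cvg_cexp (z := z).
exists N => k /HN; rewrite /nrm !normc_def -/(nrm _).
set a := series _ k; set b := series _ k.
suff -> : b = (a^*)%C by case: a => a1 a2; case: (cexp z) => c1 c2 /=;
  rewrite -opprD sqrrN.
rewrite /a /b /series /= rmorph_sum; apply: eq_bigr => i _.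
by rewrite rmorphM rmorphXn fmorphV rmorph_nat.
Qed.

Lemma cexp_real x : cexp (x%:C) = (expR x)%:C.
Proof.
apply: cexp_uniq; apply/cvg_nrmP => e e0.
have /cvgrPdist_le/(_ e e0)[N _ HN] := is_cvg_series_exp_coeff x.
exists N => k /HN; rewrite distrC -nrm_real rmorphB /=.
congr (nrm (_ - _) <= e); rewrite /series /= rmorph_sum; apply: eq_bigr => i _.
by rewrite /exp_coeff /= rmorphM rmorphXn fmorphV rmorph_nat mulrC.
Qed.

(** The squares agree: |e^z|^2 is e^z times its conjugate, that is, e^(2 Re z). *)
Lemma nrm_cexp z : nrm (cexp z) = expR (complex.Re z).
Proof.
have E : nrm (cexp z) ^+ 2 = expR (complex.Re z) ^+ 2.
  have -> : nrm (cexp z) ^+ 2 = nrm (cexp z * (cexp z)^*%C).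
    rewrite nrmM expr2; congr (_ * _); rewrite /nrm !normc_def.
    by case: (cexp z) => a b /=; rewrite sqrrN.
  rewrite -cexp_conj -cexpD.
  have -> : z + (z^*)%C = (complex.Re z + complex.Re z)%:C.
    by case: z => a b; rewrite /= ; apply/eqP; rewrite eq_complex /= subrr !eqxx.
  by rewrite cexp_real nrm_real expRD ger0_norm ?mulr_ge0 ?expR_ge0 // expr2.
apply/eqP; rewrite -(@eqrXn2 _ 2) ?nrm_ge0 ?expR_ge0 //; exact/eqP.
Qed.

Lemma logdisc_nrm (r : \bar R) z : logdisc r z <-> ((expR (complex.Re z))%:E < r)%E.
Proof. by rewrite /logdisc /disc /= -nrm_normc nrm_cexp. Qed.

(** [logdisc r] is the half-plane Re u < ln r, hence convex, so that equations in u can be followed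
    along segments. *)
Lemma logdisc_seg (r : \bar R) u v (t : R) :
  logdisc r u -> logdisc r v -> 0 <= t <= 1 -> logdisc r (seg u v t).
Proof.
move=> /logdisc_nrm ru /logdisc_nrm rv /andP[t0 t1]; apply/logdisc_nrm.
have Es : complex.Re (seg u v t) =
    complex.Re u + t * (complex.Re v - complex.Re u).
  by rewrite /seg; case: u v {ru rv} => a b [c d] /=; rewrite mul0r subr0.
have [uv|/ltW vu] := leP (complex.Re u) (complex.Re v).
  apply: le_lt_trans rv; rewrite lee_fin ler_expR Es; nra.
apply: le_lt_trans ru; rewrite lee_fin ler_expR Es; nra.
Qed.

Lemma logdisc_near (r : \bar R) : (0 < r)%E ->
  exists N, forall k, (N <= k)%N -> logdisc r (- k%:R).
Proof.
move=> r0.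
suff [x Hx] : exists x : R, forall y : R, y <= x -> ((expR y)%:E < r)%E.
  exists (Num.bound `|x|) => k Nk; apply/logdisc_nrm; apply: Hx.
  have -> : complex.Re (- k%:R : Cplx R) = - k%:R.
    by rewrite -(rmorph_nat (real_complex R)) /=.
  rewrite lerNl; apply: le_trans (ler_norm _) _; rewrite normrN.
  apply: le_trans (ltW (archi_boundP (normr_ge0 x))) _.
  by rewrite ler_nat.
case: r r0 => [r||] //; last by exists 0 => y _; rewrite ltry.
rewrite lte_fin => r0; exists (ln (r / 2)) => y.
rewrite -ler_expR lnK ?posrE ?divr_gt0 // lte_fin => H.
by apply: le_lt_trans H _; rewrite ltr_pdivrMr // ltr_pMr // ltr1n.
Qed.

(** The term of degree m + 1 in the series of e^(k + 1) beats the power m with a factor 1 / (k + 1)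
    to spare. *)
Lemma pow_expN_cvg0 m (c : R) :
  forall e : R, 0 < e -> exists N, forall k, (N <= k)%N ->
    c * k.+1%:R ^+ m * expR (- k%:R) <= e.
Proof.
move=> e e0.
pose b := `|c| * (expR 1 * m.+1`!%:R).
have b0 : 0 <= b by rewrite !mulr_ge0 // expR_ge0.
exists (Num.bound (b / e)) => k Nk.
have k0 : 0 < k.+1%:R :> R by rewrite ltr0n.
have H1 : k.+1%:R ^+ m * expR (- k%:R : R) <= expR 1 * m.+1`!%:R / k.+1%:R.
  rewrite ler_pdivlMr // mulrAC -exprSr.
  have := @expR_ge1Dxn R k.+1%:R m (ltW k0).
  rewrite -natr1 expRD => H.
  have {H} H : (k%:R + 1 : R) ^+ m.+1 <= expR k%:R * expR 1 * m.+1`!%:R.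
    by rewrite -ler_pdivrMr ?ltr0n ?fact_gt0 //; apply: le_trans H; rewrite lerDr.
  rewrite expRN ler_pdivrMr ?expR_gt0 //; apply: le_trans H _.
  by rewrite le_eqVlt; apply/orP; left; apply/eqP; ring.
rewrite -mulrA; apply: (@le_trans _ _ (`|c| * (expR 1 * m.+1`!%:R / k.+1%:R))).
  apply: (@le_trans _ _ (`|c| * (k.+1%:R ^+ m * expR (- k%:R)))).
    by rewrite ler_wpM2r ?ler_norm // mulr_ge0 ?expR_ge0 // exprn_ge0.
  by rewrite ler_wpM2l.
rewrite mulrA -/b ler_pdivrMr // mulrC -ler_pdivrMr //.
have be0 : 0 <= b / e by rewrite divr_ge0 // ltW.
apply: le_trans (ltW (archi_boundP be0)) _.
by rewrite ler_nat; apply: leq_trans Nk _.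
Qed.

End ComplexExponential.

#[local] Opaque mexp.

(** * Limits of solutions of linear equations *)

Section OdeLimit.
Variables (R : realType) (m n : nat).
Local Notation M := 'M[Cplx R]_(m, n).

(** Pointwise convergence of the solutions suffices: near [v0] they are uniformly bounded and
    uniformly Lipschitz, so each satisfies the same linear approximation estimate, and the latter
    survives the limit. *)
Lemma ode_limit (Tk : nat -> Cplx R -> M -> M) (T : Cplx R -> M -> M)
    (fk : nat -> Cplx R -> M) (f : Cplx R -> M) (v0 : Cplx R) (K : R) N0 :
  (forall k (v : Cplx R), (N0 <= k)%N -> is_derive v 1 (fk k) (Tk k v (fk k v))) ->
  (forall e : R, 0 < e -> exists N, forall k v X, (N <= k)%N -> nrm (v - v0) <= 1 ->
     nrm (Tk k v X - T v X) <= e * nrm X) ->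
  (forall e : R, 0 < e -> exists2 d : R, 0 < d & forall v X, nrm (v - v0) <= d ->
     nrm (T v X - T v0 X) <= e * nrm X) ->
  0 <= K -> (forall X, nrm (T v0 X) <= K * nrm X) ->
  (forall X Y, T v0 (X - Y) = T v0 X - T v0 Y) ->
  (forall v, (fun k => fk k v) @ \oo --> f v) ->
  is_derive v0 1 f (T v0 (f v0)).
Proof.
move=> Hder HTk HT K0 HK Tlin Hf.
apply/is_derive_nrmP => e e0.
(* [K'] bounds [Tk] near [v0]: K for the limit operator at [v0], and 1 for each of the two
   differences. [L] is the bound from [gronwall] at k = 1, the solutions having norm at most |f(v0)|
   + 1 at [v0]. *)
pose K' := K + 2; pose L := 2 ^+ 2 * (nrm (f v0) + 1).
have K'0 : 0 < K' by rewrite ltr_wpDl.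
have L0 : 0 <= L by rewrite mulr_ge0 // addr_ge0 ?nrm_ge0.
(* L twice, for the error of [Tk] against [T] and for the variation of [T]; K K' L for the variation
   of the solution under [T v0]. *)
pose C := 2 * L + K * K' * L + 1.
have C0 : 0 < C.
  rewrite ltr_wpDl // addr_ge0 //; first exact: mulr_ge0.
  by apply: mulr_ge0 => //; apply: mulr_ge0 => //; exact: ltW.
pose e1 := e / C; have e10 : 0 < e1 by rewrite divr_gt0.
have [d1 d10 Hd1] := HT 1 ltr01; have [d2 d20 Hd2] := HT e1 e10.
have [N1 HN1] := HTk 1 ltr01; have [N2 HN2] := HTk e1 e10.
have /cvg_nrmP/(_ 1 ltr01)[N3 HN3] := Hf v0.
pose d := Num.min (Num.min 1 (Num.min d1 d2)) (Num.min (1 / 2 / K') e1).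
have d0 : 0 < d.
  by rewrite !lt_min ltr01 d10 d20 e10 divr_gt0 // divr_gt0.
exists d => // h hd; rewrite [h *: 1]mulr1.
pose N := maxn (maxn N0 N1) (maxn N2 N3).
have segd (w : Cplx R) (t : R) : nrm w <= d -> 0 <= t <= 1 ->
    nrm (seg v0 (v0 + w) t - v0) <= d.
  move=> wd /andP[t0 t1]; rewrite /seg [v0 + w]addrC addrK [v0 + _]addrC addrK.
  rewrite nrmM nrm_real ger0_norm //; apply: le_trans wd.
  by rewrite -[leRHS]mul1r ler_wpM2r ?nrm_ge0.
have dle (x : R) : x <= d -> [/\ x <= 1, x <= d1, x <= d2, x <= 1 / 2 / K' & x <= e1].
  by rewrite !le_min => /andP[/andP[-> /andP[-> ->]] /andP[-> ->]].
have step k : (N <= k)%N ->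
    nrm (fk k (v0 + h) - fk k v0 - h *: T v0 (fk k v0)) <= e * nrm h.
  rewrite !geq_max => /andP[/andP[k0 k1] /andP[k2 k3]].
  have Tb v X : nrm (v - v0) <= d -> nrm (Tk k v X) <= K' * nrm X.
    move=> /dle[v1 v2 _ _ _].
    have -> : Tk k v X = (Tk k v X - T v X) + (T v X - T v0 X) + T v0 X.
      by rewrite addrA !subrK.
    apply: le_trans (ler_nrmD _ _) _; rewrite /K' addrC mulrDl; apply: lerD => //.
    apply: le_trans (ler_nrmD _ _) _.
    by rewrite -[2]/(1 + 1) mulrDl; apply: lerD; [exact: HN1|exact: Hd1].
  have fb w : nrm w <= d -> nrm (fk k (v0 + w)) <= L.
    move=> wd; have [_ _ _ w3 _] := dle _ wd.
    have G := @gronwall _ _ _ (fk k) (fun v => Tk k v (fk k v)) K' 1 v0 (v0 + w).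
    apply: (@le_trans _ _ (2 ^+ 2 * nrm (fk k v0))).
      apply: G; first exact: ltW.
        by rewrite [v0 + w]addrC addrK mulrC -ler_pdivlMr.
      move=> t t01; split; first exact: Hder.
      by apply: Tb; exact: segd.
    rewrite ler_wpM2l ?exprn_ge0 //.
    rewrite -[fk k v0](subrK (f v0)); apply: le_trans (ler_nrmD _ _) _.
    by rewrite addrC lerD2l HN3.
  have fl w : nrm w <= d -> nrm (fk k (v0 + w) - fk k v0) <= K' * L * nrm w.
    move=> wd.
    have := @mean_value _ _ _ (fk k) (fun v => Tk k v (fk k v)) v0 (v0 + w) (K' * L).
    rewrite (_ : v0 + w - v0 = w); last by rewrite addrC addKr.
    apply=> t t01; split; first exact: Hder.
    have sd := segd w t wd t01.
    apply: le_trans (Tb _ _ sd) _; rewrite ler_wpM2l // ?(ltW K'0) //.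
    by have := fb _ sd; rewrite [v0 + _]addrC subrK.
  (* Subtracting the linear function of slope [c] lets the mean value inequality bound the remainder
     of the linear approximation. *)
  set c := T v0 (fk k v0).
  have := @mean_value _ _ _ (fun v => fk k v - (v - v0) *: c)
    (fun v => Tk k v (fk k v) - c) v0 (v0 + h) e.
  rewrite (_ : v0 + h - v0 = h); last by rewrite addrC addKr.
  rewrite [v0 - v0]subrr scale0r subr0 [_ - _ *: c - _]addrAC.
  apply=> t t01; split.
    have Ha (z : Cplx R) : is_derive z 1 (fun v : Cplx R => (v - v0) *: c) c.
      apply/is_derive_nrmP => e' e'0; exists 1 => // g _.
      rewrite [g *: 1]mulr1 -!scalerBl (_ : _ - _ = 0) ?scale0r ?nrm0.
        by rewrite mulr_ge0 ?nrm_ge0 ?ltW.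
      by rewrite opprB addrA subrK addrAC addrK subrr.
    by have := is_deriveB (Hder k (seg v0 (v0 + h) t) k0) (Ha (seg v0 (v0 + h) t)).
  have sd := segd h t hd t01; have [v1 v2 v3 v4 v5] := dle _ sd.
  move: (seg _ _ _) sd v1 v2 v3 v4 v5 => v sd v1 v2 v3 v4 v5.
  have fv : nrm (fk k v) <= L by have := fb _ sd; rewrite [v0 + _]addrC subrK.
  have -> : Tk k v (fk k v) - c = (Tk k v (fk k v) - T v (fk k v))
     + (T v (fk k v) - T v0 (fk k v)) + T v0 (fk k v - fk k v0).
    by rewrite Tlin /c !addrA !subrK.
  have -> : e = e1 * L + e1 * L + (e1 * (K * K' * L) + e1).
    by rewrite -[LHS](divfK (lt0r_neq0 C0) e) -/e1 /C; clearbody e1; ring.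
  apply: le_trans (ler_nrmD _ _) _; apply: lerD.
    apply: le_trans (ler_nrmD _ _) _; apply: lerD.
      by apply: le_trans (HN2 _ _ _ k2 v1) _; rewrite ler_wpM2l // ltW.
    by apply: le_trans (Hd2 _ _ v3) _; rewrite ler_wpM2l // ltW.
  apply: (@le_trans _ _ (e1 * (K * K' * L))); last by rewrite lerDl ltW.
  have H1 : nrm (fk k v - fk k v0) <= K' * L * nrm (v - v0).
    by have := fl _ sd; rewrite [v0 + _]addrC subrK.
  have H2 : K' * L * nrm (v - v0) <= K' * L * e1.
    by rewrite ler_wpM2l // mulr_ge0 // ltW.
  apply: le_trans (HK _) _; apply: le_trans (ler_wpM2l K0 (le_trans H1 H2)) _.
  by rewrite le_eqVlt; apply/orP; left; apply/eqP; clearbody e1 K' L; ring.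
suff HT0 : (fun k => T v0 (fk k v0)) @ \oo --> T v0 (f v0).
  apply: (cvg_nrm_le (N := N) _ step).
  exact: cvg_subZ (Hf (v0 + h)) (Hf v0) HT0.
apply/cvg_nrmP => e' e'0.
have K1 : 0 < K + 1 by rewrite ltr_wpDl.
have /cvg_nrmP/(_ (e' / (K + 1)) (divr_gt0 e'0 K1))[N' HN'] := Hf v0.
exists N' => k /HN' H; rewrite -Tlin; apply: le_trans (HK _) _.
rewrite ler_pdivlMr // in H; apply: le_trans H.
by rewrite mulrC ler_wpM2l ?nrm_ge0 // lerDl.
Qed.

End OdeLimit.

(** * Exponentials under commutator relations *)

Section MatrixIdentities.
Variables (R : realType) (n : nat).
Implicit Types M C : 'M[Cplx R]_n.

Lemma exprSmx M k : M ^+ k.+1 = M *m M ^+ k.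
Proof. by rewrite exprS. Qed.

(** M^k satisfies [M^k, C] = k M^k, while bracketing with C has norm at most 2 n |C|. Once k exceeds
    this bound, M^k must vanish. *)
Lemma commutator_nilpotent M C : M *m C - C *m M = M -> exists N, M ^+ N = 0.
Proof.
move=> MC.
have pow k : M ^+ k *m C - C *m M ^+ k = k%:R *: M ^+ k.
  elim: k => [|k IH].
    by rewrite expr0 scale0r; change (1%:M *m C - C *m 1%:M = 0);
      rewrite mul1mx mulmx1 subrr.
  rewrite exprSmx -mulmxA -[M ^+ k *m C](subrK (C *m M ^+ k)) IH.
  rewrite mulmxDr -scalemxAr mulmxA -addrA mulmxA -mulmxBl MC.
  by rewrite -natr1 scalerDl scale1r.
pose x := 2 * (n%:R * nrm C); have x0 : 0 <= x by rewrite !mulr_ge0 ?nrm_ge0.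
exists (Num.bound x); set N := Num.bound x.
have xN : x < N%:R by exact: archi_boundP.
apply: nrm0_eq0; apply/eqP; rewrite eq_le nrm_ge0 andbT.
have : N%:R * nrm (M ^+ N) <= x * nrm (M ^+ N).
  rewrite -nrm_natr -nrmZ -pow; apply: le_trans (ler_nrmB _ _) _.
  rewrite /x -mulrA -[2]/(1 + 1) mulrDl mul1r; apply: lerD.
    by apply: le_trans (nrm_mulmx _ _) _; rewrite -mulrA [nrm C * _]mulrC.
  by apply: le_trans (nrm_mulmx _ _) _; rewrite -mulrA.
by rewrite -subr_ge0 -mulrBl nmulr_rge0 ?subr_lt0.
Qed.

(** Only the terms of degree below N survive in the exponential series. *)
Lemma nrm_mexp_nilpotent M N : M ^+ N = 0 ->
  exists2 c : R, 0 <= c & forall s, nrm (mexp (s *: M)) <= c * (1 + nrm s) ^+ N.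
Proof.
move=> MN; exists (\sum_(0 <= k < N) nrm (M ^+ k)).
  by rewrite sumr_ge0 // => k _; exact: nrm_ge0.
move=> s; set S := (1 + nrm s).
have S1 : 1 <= S by rewrite lerDl nrm_ge0.
have M0 k : (N <= k)%N -> M ^+ k = 0.
  by move=> /subnK <-; rewrite exprD MN; exact: mulmx0.
apply: (cvg_nrm_le (N := N) (cvg_mexp (A := s *: M))) => j Nj.
have tail0 : \sum_(N <= k < j) (k`!%:R)^-1 *: (s *: M) ^+ k = 0.
  rewrite big_nat_cond big1 // => k /andP[/andP[k1 _] _].
  by rewrite exprZmx M0 // !scaler0.
rewrite /series /= (@big_cat_nat _ _ _ N) //= tail0 addr0.
rewrite mulr_suml; apply: le_trans (ler_nrm_sum _ _ _) _.
rewrite big_nat_cond [leRHS]big_nat_cond; apply: ler_sum => k /andP[/andP[_ kN] _].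
rewrite exprZmx !nrmZ nrm_fact_inv nrmX mulrA mulrC ler_wpM2l ?nrm_ge0 //.
apply: (@le_trans _ _ (1 * S ^+ k)).
  apply: ler_pM; rewrite ?invr_ge0 ?exprn_ge0 ?nrm_ge0 //.
    by rewrite invf_le1 ?ltr0n ?fact_gt0 // ler1n fact_gt0.
  by rewrite lerXn2r ?nnegrE ?nrm_ge0 // ?(le_trans ler01) // /S lerDr.
by rewrite mul1r ler_weXn2l // ltnW.
Qed.

(** The derivative of the conjugate in s is e^(s M) [M, C] e^(- s M) = M, so the conjugate is affine
    in s. *)
Lemma mexp_conj M C (s : Cplx R) : M *m C - C *m M = M ->
  mexp (s *: M) *m C *m mexp (- s *: M) = C + s *: M.
Proof.
move=> MC.
have alg E E' : M *m E = E *m M -> E *m E' = 1%:M ->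
    (M *m E *m C + E *m 0) *m E' + E *m C *m - (M *m E') = M.
  move=> ME EE'; rewrite mulmx0 addr0 mulmxN ME.
  have -> : E *m M *m C *m E' - E *m C *m (M *m E') =
      E *m (M *m C - C *m M) *m E' by rewrite mulmxBr mulmxBl !mulmxA.
  by rewrite MC -ME -mulmxA EE' mulmx1.
pose f z := mexp (z *: M) *m C *m mexp (- z *: M).
have D (z : Cplx R) : is_derive z 1 (fun z => f z - z *: M) 0.
  have H1 : is_derive z 1 f M.
    apply: is_derive_eq.
      apply: is_derive_mulmx (is_derive_mulmx (is_derive_mexp M z) (is_derive_cst C z 1)) _.
      exact: is_derive_mexpN.
    exact: alg (mexp_commZ M z) (mexp_mulV M z).
  have H2 : is_derive z 1 (fun z : Cplx R => z *: M) M.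
    by apply: is_derive_eq; first exact: (is_deriveZl M (is_derive_id z 1)); rewrite scale1r.
  by have := is_deriveB H1 H2; rewrite subrr.
have := is_derive0_const (a := 0) (b := s) (fun t _ => D (seg 0 s t)).
rewrite /f !scale0r oppr0 scale0r mexp0 mulmx1 mul1mx subr0.
by move/eqP; rewrite subr_eq => /eqP.
Qed.

Lemma mexp_mulVN M (z : Cplx R) : mexp (- z *: M) *m mexp (z *: M) = 1%:M.
Proof. by rewrite -{2}[z]opprK mexp_mulV. Qed.

Lemma mexp_commZN M (w : Cplx R) : M *m mexp (- w *: M) = mexp (- w *: M) *m M.
Proof. exact: mexp_commZ. Qed.

(** The conjugate D(z) = e^(- z N0) N1 e^(z N0) satisfies D' = D, as does e^z N1, and both equal N1
    at z = 0. *)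
Lemma mexp_dilation (N0 N1 : 'M[Cplx R]_n) (v : Cplx R) : N0 *m N1 - N1 *m N0 = - N1 ->
  N1 *m mexp (v *: N0) = cexp v *: (mexp (v *: N0) *m N1).
Proof.
move=> NN.
have alg E E' : N0 *m E' = E' *m N0 ->
    - (N0 *m E') *m (N1 *m E) + E' *m (0 *m E + N1 *m (N0 *m E)) =
    E' *m (N1 *m E).
  move=> NE; rewrite mul0mx add0r mulNmx NE -mulmxA addrC -mulmxBr.
  congr (_ *m _); rewrite !mulmxA.
  by rewrite -mulmxBl -[_ - _]opprB NN opprK.
pose D z := mexp (- z *: N0) *m (N1 *m mexp (z *: N0)).
have HD (z : Cplx R) : is_derive z 1 D (D z).
  apply: is_derive_eq.
    apply: is_derive_mulmx (is_derive_mexpN N0 z) _.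
    exact: is_derive_mulmx (is_derive_cst N1 z 1) (is_derive_mexp N0 z).
  exact: alg (mexp_commZN N0 z).
pose X z := D z - cexp z *: N1.
have HX (z : Cplx R) : is_derive z 1 X (X z).
  by have := is_deriveB (HD z) (is_deriveZl N1 (is_derive_cexp z)).
have X0 : X 0 = 0.
  by rewrite /X /D oppr0 !scale0r mexp0 cexp0 scale1r mul1mx mulmx1 subrr.
have /eqP : X v = 0.
  apply: (linear_ode_eq0 (df := X) ler01 X0) => t _.
  by split; [exact: HX|rewrite mul1r].
rewrite subr_eq0 => /eqP Dv.
have cancel E E' : E *m E' = 1%:M -> N1 *m E = E *m (E' *m (N1 *m E)).
  by move=> EE'; rewrite mulmxA EE' mul1mx.
rewrite scalemxAr.
rewrite -[cexp v *: N1]Dv.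
exact: cancel (mexp_mulV N0 v).
Qed.

End MatrixIdentities.

(** * Decay in x against polynomial growth in ln x *)

Section Decay.
Variables (R : realType).

Lemma nrm_cexpN_nat k : nrm (cexp (- k%:R : Cplx R)) = expR (- k%:R).
Proof. by rewrite nrm_cexp -(rmorph_nat (real_complex R)) /=. Qed.

(** A derivative at 0 alone yields the Lipschitz bound f(x) - f(0) = O(x) that the limits along x =
    e^(- k) consume. *)
Lemma is_derive_decay (V : normedModType (Cplx R)) (f : Cplx R -> V) (L : V) :
  is_derive (0 : Cplx R) 1 f L ->
  exists2 c : R, 0 <= c & exists N, forall k (x : Cplx R), (N <= k)%N ->
    nrm x <= expR (- k%:R) -> nrm (f x - f 0) <= c * expR (- k%:R).
Proof.
move=> /is_derive_lip[d d0 Hd]; have c0 : 0 <= nrm L + 1 by rewrite addr_ge0 ?nrm_ge0.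
exists (nrm L + 1) => //.
have [N HN] := pow_expN_cvg0 0 1 d0; exists N => k x /HN.
rewrite mul1r expr0 mul1r => kd xk.
have := Hd x (le_trans xk kd); rewrite add0r [x *: 1]mulr1 => /le_trans; apply.
by rewrite ler_wpM2l.
Qed.

(** For |s| <= T k each of the two exponentials is O((k + 1)^N), so the conjugate is O((k + 1)^(2 N)
    e^(- k)). *)
Lemma mexp_conj_decay n (M : 'M[Cplx R]_n) N (T c e : R) : M ^+ N = 0 ->
  0 <= T -> 0 <= c -> 0 < e ->
  exists N1, forall k (s : Cplx R) D, (N1 <= k)%N -> nrm s <= T * k%:R ->
    nrm D <= c * expR (- k%:R) ->
    nrm (mexp (s *: M) *m D *m mexp (- s *: M)) <= e.
Proof.
move=> /nrm_mexp_nilpotent[b b0 Hb] T0 c0 e0.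
pose a := n%:R * (n%:R * ((b * (1 + T) ^+ N) * c) * (b * (1 + T) ^+ N)).
have [N1 HN1] := @pow_expN_cvg0 R (N + N) a e e0; exists N1 => k s D k1 sk Dk.
apply: le_trans (HN1 k k1); pose x : R := k.+1%:R ^+ N.
have x0 : 0 <= x by rewrite exprn_ge0.
have T1 : 0 <= 1 + T by rewrite addr_ge0.
pose y := b * (1 + T) ^+ N * x.
have y0 : 0 <= y by rewrite !mulr_ge0 // exprn_ge0.
have E (w : Cplx R) : nrm w <= T * k%:R -> nrm (mexp (w *: M)) <= y.
  move=> wk; apply: le_trans (Hb w) _; rewrite /y -mulrA ler_wpM2l // /x -exprMn.
  rewrite lerXn2r ?nnegrE ?addr_ge0 ?nrm_ge0 ?mulr_ge0 //.
  apply: (@le_trans _ _ (1 + T * k%:R)); first by rewrite lerD2l.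
  rewrite -natr1.
  have k0 : 0 <= k%:R :> R by [].
  nra.
have Es := E s sk; have ENs : nrm (mexp (- s *: M)) <= y by apply: E; rewrite nrmN.
apply: (@le_trans _ _ (n%:R * (n%:R * (y * (c * expR (- k%:R))) * y))).
  move: (mexp _) Es (mexp _) ENs => E1 E1y E2 E2y.
  apply: le_trans (nrm_mulmx _ _) _; apply: ler_wpM2l => //.
  apply: ler_pM => //; [exact: nrm_ge0|exact: nrm_ge0|].
  apply: le_trans (nrm_mulmx _ _) _; apply: ler_wpM2l => //.
  by apply: ler_pM => //; exact: nrm_ge0.
rewrite le_eqVlt; apply/orP; left; apply/eqP.
by rewrite /a /y exprD -/x; ring.
Qed.

End Decay.

(** * The residue at x = 0 *)

Section System.
Variables (R : realType) (mu : nat) (Q : logQDS R mu).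
Local Notation M := (q_M1 Q 0).

Definition cl (tau : Cplx R) : 'M[Cplx R]_mu := q_N0 Q 0 + tau *: q_N1 Q 0.

Lemma q_M1_derive (x : Cplx R) : is_derive x 1 (q_M1 Q) ('D_1 (q_M1 Q) x).
Proof. by apply/derivableP/diff_derivable; case: Q => ? ? ? ? ? /= H *; exact: H. Qed.

Lemma q_N0_derive (x : Cplx R) : is_derive x 1 (q_N0 Q) ('D_1 (q_N0 Q) x).
Proof. by apply/derivableP/diff_derivable; case: Q => ? ? ? ? ? /= _ H *; exact: H. Qed.

Lemma q_N1_derive (x : Cplx R) : is_derive x 1 (q_N1 Q) ('D_1 (q_N1 Q) x).
Proof. by apply/derivableP/diff_derivable; case: Q => ? ? ? ? ? /= _ _ H *; exact: H. Qed.

Lemma q_flat : flat_connection (conn_x (q_M1 Q)) (conn_tau (q_N0 Q) (q_N1 Q)).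
Proof. by case: Q. Qed.

Lemma conn_tau_derive (x tau : Cplx R) :
  is_derive x 1 (fun s => conn_tau (q_N0 Q) (q_N1 Q) (s, tau))
    ('D_1 (q_N0 Q) x + tau *: 'D_1 (q_N1 Q) x).
Proof.
by have := is_deriveD (q_N0_derive x) (is_deriveZ tau (q_N1_derive x)).
Qed.

(* Along x = exp u the connection matrix B in the direction of tau satisfies
   dB/du = tau (M1 - [M1, B]).  If the limit of the right-hand side as
   Re u -> -oo were not 0, then B would grow like u, although it is
   continuous at x = 0. *)
Lemma residue_commutator tau : tau != 0 -> M *m cl tau - cl tau *m M = M.
Proof.
move=> t0.
pose B x := conn_tau (q_N0 Q) (q_N1 Q) (x, tau).
pose dB x := 'D_1 (q_N0 Q) x + tau *: 'D_1 (q_N1 Q) x.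
(* For x <> 0, flatness makes this the derivative of B in ln x. [flat_connection] gives no equation
   at x = 0, where [G 0] is the defect to be shown zero. *)
pose G x := tau *: (q_M1 Q x - (q_M1 Q x *m B x - B x *m q_M1 Q x)).
have HB (x : Cplx R) : is_derive x 1 B (dB x) by exact: conn_tau_derive.
have HG x : x != 0 -> x *: dB x = G x.
  move=> x0; have /= := @q_flat (x, tau) (conj x0 t0).
  have -> : xdx (conn_tau (q_N0 Q) (q_N1 Q)) (x, tau) = x *: dB x.
    by rewrite /xdx /=; congr (_ *: _);
      have /is_derive_partial1[_ ->] := HB x.
  have -> : tdt (conn_x (q_M1 Q)) (x, tau) = tau *: q_M1 Q x.
    rewrite /tdt /=; congr (_ *: _).
    have H : is_derive tau 1 (fun s => conn_x (q_M1 Q) (x, s)) (q_M1 Q x).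
      by apply: is_derive_eq; [exact: (is_deriveZl (q_M1 Q x) (is_derive_id tau 1))|rewrite scale1r].
    by have /is_derive_partial2[_ ->] := H.
  rewrite /conn_x /= -/(B x) -scalemxAl -scalemxAr => /eqP.
  rewrite -scalerBr -addrA addr_eq0 => /eqP ->.
  by rewrite opprD opprK /G !scalerBr.
have [cG cG0 [NG HNG]] : exists2 c : R, 0 <= c & exists N, forall k (x : Cplx R), (N <= k)%N ->
    nrm x <= expR (- k%:R) -> nrm (G x - G 0) <= c * expR (- k%:R).
  have H1 := is_derive_mulmx (q_M1_derive 0) (HB 0).
  have H2 := is_derive_mulmx (HB 0) (q_M1_derive 0).
  exact: is_derive_decay (is_deriveZ tau (is_deriveB (q_M1_derive 0) (is_deriveB H1 H2))).
have [cB cB0 [NB HNB]] := is_derive_decay (HB 0).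
have {}G0 : G 0 = 0.
  apply: nrm_small_eq0 => e e0.
  (* Over the unit step from u = - k - 1 to u = - k, the increment of B is [G 0] up to [cG] e^(- k),
     while both end values lie within [cB] e^(- k) of [B 0]. *)
  have [N HN] := @pow_expN_cvg0 R 0 (cG + (cB + cB)) e e0.
  pose k := maxn N (maxn NG NB); have kN : (N <= k)%N by rewrite leq_maxl.
  have kG : (NG <= k)%N by rewrite /k !leq_max leqnn orbT.
  have kB : (NB <= k)%N by rewrite /k !leq_max leqnn !orbT.
  have := HN k kN; rewrite expr0 mulr1; apply: le_trans.
  pose a : Cplx R := - k.+1%:R; pose b : Cplx R := - k%:R.
  have ba : b - a = 1 by rewrite /a /b opprK -natr1 addrA addNr add0r.
  have E (x y g : 'M[Cplx R]_mu) :
      x - (b - a) *: g - (y - (a - a) *: g) = x - g - y.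
    by rewrite ba [a - a]subrr scale1r scale0r subr0.
  have H : nrm (B (cexp b) - G 0 - B (cexp a)) <= cG * expR (- k%:R) * nrm (b - a).
    rewrite -E; apply: (@mean_value _ _ _ (fun u => B (cexp u) - (u - a) *: G 0)
      (fun u => G (cexp u) - G 0)) => t /andP[t0' t1]; split.
      have Hc : is_derive (seg a b t) 1 (fun u => B (cexp u)) (G (cexp (seg a b t))).
        by rewrite -(HG _ (cexp_neq0 (seg a b t))); exact: is_derive_chain (is_derive_cexp _) (HB _).
      have Hl : is_derive (seg a b t) 1 (fun u : Cplx R => (u - a) *: G 0) (1 *: G 0).
        apply: is_deriveZl; apply/is_derive_nrmP => e' e'0; exists 1 => // g _.
        rewrite [g *: 1]mulr1 (_ : _ - _ - _ = 0) ?nrm0 ?mulr_ge0 ?nrm_ge0 ?ltW //.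
        by ring.
      by have := is_deriveB Hc Hl; rewrite scale1r.
    apply: HNG => //; rewrite nrm_cexp ler_expR /seg ba mulr1 /a.
    by rewrite -(rmorph_nat (real_complex R)) /= -natr1; lra.
  rewrite ba nrm1 mulr1 in H.
  have Hb : nrm (B (cexp b) - B 0) <= cB * expR (- k%:R).
    by apply: HNB => //; rewrite nrm_cexpN_nat.
  have Ha : nrm (B (cexp a) - B 0) <= cB * expR (- k%:R).
    apply: HNB => //; rewrite nrm_cexpN_nat ler_expR lerN2 ler_nat //.
  have D (x y z g : 'M[Cplx R]_mu) :
      nrm g <= nrm (x - g - y) + (nrm (x - z) + nrm (y - z)).
    have Eg : g = - (x - g - y) + ((x - z) - (y - z)).
      by apply/matrixP => i j; rewrite !mxE; ring.
    rewrite {1}Eg; apply: le_trans (ler_nrmD _ _) _; rewrite nrmN lerD2l; exact: ler_nrmB.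
  rewrite mulrDl mulrDl.
  exact: le_trans (D _ _ _ _) (lerD H (lerD Hb Ha)).
move/eqP: G0; rewrite /G scaler_eq0 (negbTE t0) /= subr_eq0 => /eqP.
by [].
Qed.

End System.

(** * Passage to the limit x = 0 *)

Section ClassicalLimit.
Variables (R : realType) (mu : nat) (Q : logQDS R mu).
Local Notation M := (q_M1 Q 0).

Lemma nrm_linear_comb (X A B : 'M[Cplx R]_mu) :
  nrm (X *m A - B *m X) <= mu%:R * (nrm A + nrm B) * nrm X.
Proof.
apply: le_trans (ler_nrmB _ _) _; rewrite mulrDr mulrDl; apply: lerD.
  by apply: le_trans (nrm_mulmx _ _) _; rewrite mulrA mulrAC.
by apply: le_trans (nrm_mulmx _ _) _; rewrite mulrA.
Qed.

Lemma q_M1_nilpotent : exists N, M ^+ N = 0.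
Proof.
exact: commutator_nilpotent (residue_commutator Q (oner_neq0 (Cplx R))).
Qed.

(* With s = - k tau, conjugating by e^(s M) turns the equation of
   P (- k, tau) G into one whose coefficients converge as k -> oo, because
   H (x, tau) - 1 and B (x, tau) - B (0, tau) are O(x) while e^(s M) grows
   polynomially in k. *)
Lemma classical_limit (r : \bar R) (H : Cplx R * Cplx R -> 'M[Cplx R]_mu)
    (G T : Cplx R -> 'M[Cplx R]_mu) (k0 : nat) :
  (0 < r)%E -> holomorphic (disc r `*` setT) H ->
  (forall tau, H (0, tau) = 1%:M) ->
  (forall v : Cplx R, exists L, is_derive v 1 T L) ->
  (forall k (v : Cplx R), (k0 <= k)%N ->
    is_derive v 1 (fun w => twisted_solution Q H (- k%:R, cexp w) *m G w)
      (twisted_solution Q H (- k%:R, cexp v) *m G v *m T v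
       - conn_tau (q_N0 Q) (q_N1 Q) (cexp (- k%:R), cexp v)
         *m (twisted_solution Q H (- k%:R, cexp v) *m G v))) ->
  forall v : Cplx R, is_derive v 1 G (G v *m T v - cl Q (cexp v) *m G v).
Proof.
move=> r0 H_holo H_0 T_der G_der v0.
have [N MN] := q_M1_nilpotent.
(* At u = - k the twisted solution is H times [E'], so multiplying by [E] on the left turns it into
   a conjugate of H. *)
pose s k v : Cplx R := cexp v * - k%:R.
pose E k v := mexp (s k v *: M).
pose E' k v := mexp (- s k v *: M).
pose B k v := conn_tau (q_N0 Q) (q_N1 Q) (cexp (- k%:R), cexp v).
pose Y k v := twisted_solution Q H (- k%:R, cexp v) *m G v.
pose fk k v := E k v *m Y k v.
(* The multiple of M comes from differentiating [E]: the derivative of s in v = ln tau is s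
   itself. *)
pose Tk k v (X : 'M[Cplx R]_mu) := X *m T v - (E k v *m B k v *m E' k v - s k v *: M) *m X.
pose T0 v (X : 'M[Cplx R]_mu) := X *m T v - cl Q (cexp v) *m X.
have cl_conj k v : E k v *m cl Q (cexp v) *m E' k v = cl Q (cexp v) + s k v *: M.
  exact: mexp_conj (residue_commutator Q (cexp_neq0 v)).
have fk_der k (v : Cplx R) : (k0 <= k)%N -> is_derive v 1 (fk k) (Tk k v (fk k v)).
  move=> /G_der HY.
  have Hs : is_derive v 1 (s k) (s k v).
    exact: (is_deriveZl (- k%:R : Cplx R) (is_derive_cexp v)).
  have HE : is_derive v 1 (E k) (s k v *: (M *m E k v)).
    exact: is_derive_chain Hs (is_derive_mexp M (s k v)).
  have alg (e e' y b t m : 'M[Cplx R]_mu) : e' *m e = 1%:M ->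
      m *m e *m y + e *m (y *m t - b *m y) =
      (e *m y) *m t - (e *m b *m e' - m) *m (e *m y).
    move=> ee; rewrite mulmxBr mulmxBl opprB.
    have -> : e *m b *m e' *m (e *m y) = e *m (b *m y).
      by rewrite -!mulmxA [e' *m _]mulmxA ee mul1mx.
    by rewrite !mulmxA addrCA.
  have := is_derive_mulmx HE (HY v).
  rewrite scalemxAl (alg _ (E' k v)) //; exact: mexp_mulVN.
pose Tm := expR (complex.Re v0 + 1); have Tm0 : 0 <= Tm by exact: expR_ge0.
have exp_le v : nrm (v - v0) <= 1 -> nrm (cexp v) <= Tm.
  move=> vv; rewrite nrm_cexp ler_expR -lerBlDl.
  have := le_trans (ler_norm _) (le_trans (nrm_Re _) vv).
  by rewrite (_ : complex.Re (v - v0) = complex.Re v - complex.Re v0) ?raddfB.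
have s_le k v : nrm (v - v0) <= 1 -> nrm (s k v) <= Tm * k%:R.
  by move=> vv; rewrite nrmM nrmN nrm_natr ler_wpM2r // exp_le.
apply: (@ode_limit _ _ _ Tk T0 fk G v0 (mu%:R * (nrm (T v0) + nrm (cl Q (cexp v0)))) k0).
(* Uniform convergence of the coefficients: by [cl_conj] the terms in s M cancel and the conjugate
   of B(x, tau) - B(0, tau) remains. *)
- move=> e e0.
  have mu1 : 0 < mu%:R + 1 :> R by rewrite ltr_wpDl.
  have [c0 c00 [n0 Hn0]] := is_derive_decay (q_N0_derive Q 0).
  have [c1 c10 [n1 Hn1]] := is_derive_decay (q_N1_derive Q 0).
  have c20 : 0 <= c0 + Tm * c1 by rewrite addr_ge0 // mulr_ge0.
  have [n2 Hn2] := mexp_conj_decay MN Tm0 c20 (divr_gt0 e0 mu1).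
  exists (maxn n0 (maxn n1 n2)) => k v X; rewrite !geq_max => /andP[kn0 /andP[kn1 kn2]] vv.
  have -> : Tk k v X - T0 v X =
      - (E k v *m (B k v - cl Q (cexp v)) *m E' k v *m X).
    have alg (e1 e2 b c m x t : 'M[Cplx R]_mu) : e1 *m c *m e2 = c + m ->
        x *m t - (e1 *m b *m e2 - m) *m x - (x *m t - c *m x) =
        - (e1 *m (b - c) *m e2 *m x).
      move=> ce; rewrite mulmxBr !mulmxBl ce mulmxDl.
      move: (_ *m x) (m *m x) (x *m t) (c *m x) => x1 x2 x3 x4.
      by apply/matrixP => i j; rewrite !mxE; ring.
    exact: alg (cl_conj k v).
  rewrite nrmN; apply: le_trans (nrm_mulmx _ _) _.
  rewrite mulrA ler_wpM2r ?nrm_ge0 //.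
  apply: (@le_trans _ _ ((mu%:R + 1) * (e / (mu%:R + 1)))); last first.
    by rewrite mulrC divfK ?gt_eqF.
  apply: ler_pM => //; [exact: nrm_ge0|by rewrite lerDl|].
  apply: (Hn2 k) => //; first exact: s_le.
  have xk : nrm (cexp (- k%:R : Cplx R)) <= expR (- k%:R) by rewrite nrm_cexpN_nat.
  have := Hn0 k _ kn0 xk; have := Hn1 k _ kn1 xk => h1 h0.
  rewrite /B /conn_tau /cl /= opprD addrACA -scalerBr mulrDl -mulrA.
  apply: le_trans (ler_nrmD _ _) _; apply: lerD => //.
  by rewrite nrmZ; apply: ler_pM; rewrite ?nrm_ge0 ?exp_le.
(* Continuity at [v0] of the limiting coefficients. *)
- move=> e e0.
  have [LT /is_derive_lip[d1 d10 Hd1]] := T_der v0.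
  have [d2 d20 Hd2] := is_derive_lip (is_derive_cexp v0).
  pose a := nrm LT + 1; pose b := nrm (cexp v0) + 1; pose c := nrm (q_N1 Q 0).
  have a0 : 0 <= a by rewrite addr_ge0 ?nrm_ge0.
  have b0 : 0 <= b by rewrite addr_ge0 ?nrm_ge0.
  have c0 : 0 <= c by exact: nrm_ge0.
  pose C := mu%:R * (a + b * c) + 1.
  have C0 : 0 < C.
    by rewrite ltr_wpDl // mulr_ge0 // addr_ge0 // mulr_ge0.
  exists (Num.min (Num.min d1 d2) (e / C)).
    by rewrite !lt_min d10 d20 divr_gt0.
  move=> v X; rewrite !le_min => /andP[/andP[vd1 vd2] vd3].
  have Ev : v0 + (v - v0) *: 1 = v by rewrite [_ *: 1]mulr1 addrC subrK.
  have := Hd1 _ vd1; have := Hd2 _ vd2; rewrite Ev => h2 h1.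
  have -> : T0 v X - T0 v0 X =
      X *m (T v - T v0) - (cl Q (cexp v) - cl Q (cexp v0)) *m X.
    have alg (x t t0 p p0 : 'M[Cplx R]_mu) :
        x *m t - p *m x - (x *m t0 - p0 *m x) = x *m (t - t0) - (p - p0) *m x.
      rewrite mulmxBr mulmxBl; move: (x *m t) (x *m t0) (p *m x) (p0 *m x).
      by move=> x1 x2 x3 x4; apply/matrixP => i j; rewrite !mxE; ring.
    exact: alg.
  apply: le_trans (nrm_linear_comb _ _ _) _; rewrite ler_wpM2r ?nrm_ge0 //.
  have -> : cl Q (cexp v) - cl Q (cexp v0) = (cexp v - cexp v0) *: q_N1 Q 0.
    by rewrite /cl opprD addrACA subrr add0r scalerBl.
  rewrite nrmZ -/c.
  apply: (@le_trans _ _ (mu%:R * (a * nrm (v - v0) + b * nrm (v - v0) * c))).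
    by rewrite ler_wpM2l // lerD // ler_wpM2r.
  rewrite (_ : mu%:R * _ = mu%:R * (a + b * c) * nrm (v - v0)); last by ring.
  rewrite ler_pdivlMr // mulrC in vd3; apply: le_trans vd3.
  by rewrite ler_wpM2r ?nrm_ge0 // lerDl.
- by rewrite mulr_ge0 // addr_ge0 ?nrm_ge0.
- by move=> X; exact: nrm_linear_comb.
- move=> X X'; rewrite /T0.
  move: (cl _ _) (T v0) => c t; rewrite mulmxBl mulmxBr.
  move: (X *m t) (X' *m t) (c *m X) (c *m X') => x1 x2 x3 x4.
  by apply/matrixP => i j; rewrite !mxE; ring.
(* Pointwise convergence of the solutions: the difference from G is the conjugate of H - 1, applied
   to G. *)
move=> v; apply/cvg_nrmP => e e0.
have H_diff : differentiable H (0, cexp v).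
  apply: H_holo; split => //; by rewrite /disc /mkset -nrm_normc nrm0.
have [LH HL] : exists L, is_derive (0 : Cplx R) 1 (fun x => H (x, cexp v)) L.
  exists ('D_(1, 0) H (0, cexp v)); apply/is_derive_partial1.
  by apply/derivableP; exact: diff_derivable.
have [c c0 [n0 Hn0]] := is_derive_decay HL.
pose S := expR (complex.Re v).
have g1 : 0 < mu%:R * nrm (G v) + 1 by rewrite ltr_wpDl // mulr_ge0 ?nrm_ge0.
have [n1 Hn1] := mexp_conj_decay MN (expR_ge0 (complex.Re v)) c0 (divr_gt0 e0 g1).
exists (maxn n0 n1) => k; rewrite geq_max => /andP[kn0 kn1].
have -> : fk k v - G v =
    E k v *m (H (cexp (- k%:R), cexp v) - 1%:M) *m E' k v *m G v.
  have alg (e1 e2 h g : 'M[Cplx R]_mu) : e1 *m e2 = 1%:M ->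
      e1 *m (h *m e2 *m g) - g = e1 *m (h - 1%:M) *m e2 *m g.
    by move=> ee; rewrite mulmxBr mulmx1 !mulmxBl ee mul1mx !mulmxA.
  rewrite -alg; last exact: mexp_mulV.
  by [].
apply: le_trans (nrm_mulmx _ _) _; rewrite mulrA mulrAC.
apply: (@le_trans _ _ ((mu%:R * nrm (G v) + 1) * (e / (mu%:R * nrm (G v) + 1)))).
  apply: ler_pM; [by rewrite mulr_ge0 ?nrm_ge0|exact: nrm_ge0|by rewrite lerDl|].
  apply: (Hn1 k) => //; first by rewrite nrmM nrmN nrm_natr nrm_cexp.
  rewrite -(H_0 (cexp v)); apply: Hn0 => //.
  by rewrite nrm_cexpN_nat.
by rewrite mulrC divfK ?gt_eqF.
Qed.

End ClassicalLimit.

(** * Polynomials in tau and the explicit classical solution *)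

Lemma poly_cexp_eq0 (R : realType) (p : {poly Cplx R}) :
  (forall v, p.[cexp v] = 0) -> p = 0.
Proof.
(* The numbers e^(- k) for k below the size of p are distinct roots, too many for a nonzero p. *)
move=> H; pose rs := [seq cexp (- k%:R : Cplx R) | k <- iota 0 (size p)].
apply: (@roots_geq_poly_eq0 _ p rs).
- by apply/allP => _ /mapP[k _ ->]; apply/rootP; exact: H.
- suff inj : injective (fun k => cexp (- k%:R : Cplx R)).
    by rewrite (map_inj_uniq inj) iota_uniq.
  move=> i j E.
  have : expR (- i%:R : R) = expR (- j%:R).
    by rewrite -nrm_cexpN_nat E nrm_cexpN_nat.
  by move/expR_inj/oppr_inj/eqP; rewrite eqr_nat => /eqP.
- by rewrite size_map size_iota.
Qed.

(** Two polynomials in tau that agree at all e^v have equal coefficients, so R_0 = A and R_1 = B,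
    and the relation for k = 1 is the claim. *)
Lemma conformal_residue (R : realType) n (A B : 'M[Cplx R]_n) (delta : nat)
    (Rk : nat -> 'M[Cplx R]_n) :
  (forall k, (1 <= k <= delta)%N ->
     Rk 0%N *m Rk k - Rk k *m Rk 0%N = - (k%:R *: Rk k)) ->
  (forall v, \sum_(k < delta.+1) cexp v ^+ k *: Rk k = A + cexp v *: B) ->
  A *m B - B *m A = - B.
Proof.
move=> comm H.
have Hp i j : \poly_(k < delta.+1) (Rk k i j) = (A i j)%:P + B i j *: 'X.
  apply/eqP; rewrite -subr_eq0; apply/eqP/poly_cexp_eq0 => v.
  rewrite hornerD hornerN hornerD hornerZ hornerC hornerX horner_poly.
  have := congr1 (fun X : 'M[Cplx R]_n => X i j) (H v).
  rewrite summxE !mxE => E.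
  rewrite (_ : \sum_(k < _) _ = A i j + cexp v * B i j).
    by rewrite mulrC subrr.
  by rewrite -E; apply: eq_bigr => k _; rewrite mxE mulrC.
have E0 : Rk 0%N = A.
  apply/matrixP => i j; have := congr1 (fun p : {poly _} => p`_0) (Hp i j).
  by rewrite coef_poly coefD coefC coefZ coefX /= mulr0 addr0.
have E1 : (if (1 < delta.+1)%N then Rk 1%N else 0) = B.
  apply/matrixP => i j; have := congr1 (fun p : {poly _} => p`_1) (Hp i j).
  rewrite coef_poly coefD coefC coefZ coefX /= mulr1 add0r => <-.
  by case: ifP => // _; rewrite mxE.
(* When [delta] is 0 there is no term of degree one: B is 0 and both sides vanish. *)
move: E1; case: ifP => [d1 E1|_ <-]; last by rewrite mulmx0 mul0mx subrr oppr0.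
by have := comm 1%N d1; rewrite E0 E1 scale1r.
Qed.

Lemma poly_cexp_derivable (R : realType) n (Rk : nat -> 'M[Cplx R]_n) delta
    (w : Cplx R) : exists L,
  is_derive w 1 (fun y => \sum_(k < delta) cexp y ^+ k *: Rk k) L.
Proof.
have cexpX k : exists L : Cplx R, is_derive w 1 (fun y => cexp y ^+ k) L.
  elim: k => [|k [L HL]]; first by exists 0; exact: (is_derive_cst (1 : Cplx R)).
  exists (cexp w *: L + cexp w ^+ k *: cexp w).
  rewrite (_ : (fun y => _) = (fun y => cexp y * cexp y ^+ k)).
    by have := is_deriveM (is_derive_cexp w) HL.
  by apply/funext => y; rewrite exprS.
elim: delta => [|d [L HL]].
  exists 0; rewrite (_ : (fun y => _) = (fun=> 0)); first exact: is_derive_cst.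
  by apply/funext => y; rewrite big_ord0.
have [L' HL'] := cexpX d; exists (L + L' *: Rk d).
rewrite (_ : (fun y => _) =
  (fun y => \sum_(k < d) cexp y ^+ k *: Rk k + cexp y ^+ d *: Rk d)).
  by have := is_deriveD HL (is_deriveZl (Rk d) HL').
by apply/funext => y; rewrite big_ord_recr.
Qed.

(* A solution of the classical equation is unique up to its value at tau = 1,
   and tau^(- N0) tau^(- N1) solves it because tau^(- N0) N1 tau^N0 = tau N1. *)
Lemma classical_solution (R : realType) n (N0 N1 : 'M[Cplx R]_n)
    (F : Cplx R -> 'M[Cplx R]_n) :
  N0 *m N1 - N1 *m N0 = - N1 ->
  (forall v : Cplx R, is_derive v 1 F (- (N0 + cexp v *: N1) *m F v)) ->
  forall v, F v = mpow v (- N0) *m mpow v (- N1) *m F 0.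
Proof.
move=> NN HF v.
(* The inverse of the claimed propagator applied to F. Moving N1 past e^(z N0) yields the factor
   e^z, which cancels the term e^z N1 of the equation. *)
pose W z := mexp (z *: N1) *m mexp (z *: N0) *m F z.
have alg (a b f : 'M[Cplx R]_n) c : N1 *m b = c *: (b *m N1) ->
    N0 *m b = b *m N0 -> N1 *m a = a *m N1 ->
    (N1 *m a *m b + a *m (N0 *m b)) *m f + a *m b *m (- (N0 + c *: N1) *m f) = 0.
  move=> N1b N0b N1a; rewrite N0b N1a -mulmxA N1b.
  rewrite -mulmxDr -[a *m b *m _]mulmxA -[a *m _ *m f]mulmxA -mulmxDr.
  rewrite mulmxA -mulmxDl mulmxN mulmxDr -scalemxAr addrC [_ + c *: _]addrC.
  by rewrite addNr mul0mx mulmx0.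
have HW (z : Cplx R) : is_derive z 1 W 0.
  have := is_derive_mulmx (is_derive_mulmx (is_derive_mexp N1 z) (is_derive_mexp N0 z)) (HF z).
  by rewrite alg //; [exact: mexp_dilation|exact: mexp_commZ|exact: mexp_commZ].
have W0 := is_derive0_const (a := 0) (b := v) (fun t _ => HW (seg 0 v t)).
have {W0} Wv : W v = F 0.
  by rewrite W0 /W !scale0r mexp0 !mul1mx.
rewrite /mpow !scalerN -!scaleNr -Wv /W.
have cancel (a a' b b' f : 'M[Cplx R]_n) : a' *m a = 1%:M -> b' *m b = 1%:M ->
    f = b' *m a' *m (a *m b *m f).
  by move=> aa bb; rewrite -!mulmxA (mulmxA a') aa mul1mx (mulmxA b') bb mul1mx.
exact: cancel (mexp_mulVN N1 v) (mexp_mulVN N0 v).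
Qed.

(** * Flat sections along x *)

Section Uniqueness.
Variables (R : realType) (mu : nat) (Q : logQDS R mu).

Lemma flat_basis_derive rho Psi (u v : Cplx R) : flat_basis Q rho Psi ->
  logdisc rho u ->
  is_derive u 1 (fun s => Psi (s, v))
    (- (conn_x (q_M1 Q) (cexp u, cexp v) *m Psi (u, v))) /\
  is_derive v 1 (fun s => Psi (u, s))
    (- (conn_tau (q_N0 Q) (q_N1 Q) (cexp u, cexp v) *m Psi (u, v))).
Proof.
move=> [Hcol _] Hu.
have col_der (p : Cplx R * Cplx R) A : (forall j, is_derive (u, v) p
    (fun q => col j (Psi q)) (- (A *m col j (Psi (u, v))))) ->
    is_derive (u, v) p Psi (- (A *m Psi (u, v))).
  move=> HA; apply/is_derive_mxP => i j.
  have /is_derive_mxP/(_ i ord0) := HA j.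
  have -> : (fun y => Psi y i j) = (fun y => col j (Psi y) i ord0).
    by apply/funext => y; rewrite mxE.
  rewrite (_ : (- (A *m col j _)) i ord0 = (- (A *m Psi (u, v))) i j) //.
  by rewrite !mxE; congr (- _); apply: eq_bigr => k _; rewrite mxE.
have dj j : differentiable (fun q => col j (Psi q)) (u, v).
  by have [Hh _] := Hcol j; apply: Hh; split.
split; [apply/is_derive_partial1|apply/is_derive_partial2]; apply: col_der => j;
  have [_ /(_ u v Hu)[H1 H2]] := Hcol j;
  apply: is_derive_eq; (try exact/derivableP/diff_derivable);
  apply/eqP; rewrite -addr_eq0; exact/eqP.
Qed.

(** The difference solves a linear equation whose coefficient is bounded on the segment from [u0] to
    [u], which stays in the half-plane by convexity. *)
Lemma flat_unique (r : \bar R) (v : Cplx R) (F G : Cplx R -> 'M[Cplx R]_mu) u0 u :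
  logdisc r u0 -> logdisc r u -> F u0 = G u0 ->
  (forall s : Cplx R, logdisc r s ->
     is_derive s 1 F (- (conn_x (q_M1 Q) (cexp s, cexp v) *m F s)) /\
     is_derive s 1 G (- (conn_x (q_M1 Q) (cexp s, cexp v) *m G s))) ->
  F u = G u.
Proof.
move=> r0 ru FG H.
pose A s := conn_x (q_M1 Q) (cexp s, cexp v).
pose dA s := cexp v *: (cexp s *: 'D_1 (q_M1 Q) (cexp s)).
have HA (s : Cplx R) : is_derive s 1 A (dA s).
  by have := is_deriveZ (cexp v) (is_derive_chain (is_derive_cexp s) (q_M1_derive Q _)).
have [K K0 HK] := seg_bounded (df := dA) (a := u0) (b := u) (fun t _ => HA (seg u0 u t)).
apply/eqP; rewrite -subr_eq0; apply/eqP.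
have muK : 0 <= mu%:R * K by rewrite mulr_ge0.
apply: (linear_ode_eq0 (f := fun s => F s - G s)
  (df := fun s => - (A s *m (F s - G s))) (a := u0) muK).
  by rewrite FG subrr.
move=> t t01; have [HF HG] := H _ (logdisc_seg r0 ru t01); split.
  by have := is_deriveB HF HG; rewrite -opprD -mulmxBr.
rewrite nrmN; apply: le_trans (nrm_mulmx _ _) _.
by rewrite mulrA ler_wpM2r ?nrm_ge0 // ler_wpM2l // HK.
Qed.

End Uniqueness.

Theorem corollary6p3p6 (R : realType) (mu : nat) (Q : logQDS R mu)
    (r rho : \bar R) (H : Cplx R * Cplx R -> 'M[Cplx R]_mu)
    (r_gt0 : (0 < r)%E) (r_le_rho : (r <= rho)%E)
    (H_holo : holomorphic (disc r `*` setT) H)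
    (H_0 : forall tau : Cplx R, H (0, tau) = 1%:M)
    (H_fund : fundamental_solution Q r (twisted_solution Q H))
    (Psi : Cplx R * Cplx R -> 'M[Cplx R]_mu)
    (Psi_basis : flat_basis Q rho Psi) :
  exists Psicl : Cplx R -> 'M[Cplx R]_mu,
    [/\ forall u v : Cplx R, logdisc r u ->
          Psi (u, v) =
            H (cexp u, cexp v) *m mexp (- (cexp v * u) *: q_M1 Q 0)
              *m Psicl v,
        forall v : Cplx R,
          is_derive v (1 : Cplx R) Psicl
            (- (q_N0 Q 0 + cexp v *: q_N1 Q 0) *m Psicl v)
      & conformal Q r (twisted_solution Q H) ->
        exists Psiconst : 'M[Cplx R]_mu,
          forall v : Cplx R,
            Psicl v =
              mpow v (- q_N0 Q 0) *m mpow v (- q_N1 Q 0) *m Psiconst].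
Proof.
pose P := twisted_solution Q H.
have [P_holo P_unit _ P_flat] := H_fund.
have [k0 Hk0] := logdisc_near r_gt0.
pose u0 : Cplx R := - k0%:R; have ru0 : logdisc r u0 by exact: Hk0.
have to_rho u : logdisc r u -> logdisc rho u.
  by move=> ru; exact: lt_le_trans ru r_le_rho.
(* [PsiE] shows that the choice of base point [u0] does not affect this matrix. *)
pose Psicl v := invmx (P (u0, cexp v)) *m Psi (u0, v).
have PsiE u v : logdisc r u -> Psi (u, v) = P (u, cexp v) *m Psicl v.
  move=> ru; apply: (flat_unique (v := v) (F := fun s => Psi (s, v))
    (G := fun s => P (s, cexp v) *m Psicl v) ru0 ru).
    by rewrite /Psicl mulmxA mulmxV ?mul1mx //; exact: P_unit.
  move=> s rs; split; first exact: (flat_basis_derive v Psi_basis (to_rho s rs)).1.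
  have dP : is_derive s 1 (fun s => P (s, cexp v))
      (- (conn_x (q_M1 Q) (cexp s, cexp v) *m P (s, cexp v))).
    apply/is_derive_partial1; apply: is_derive_eq.
      by apply/derivableP/diff_derivable; apply: P_holo; split.
    by apply/eqP; rewrite -addr_eq0; apply/eqP; exact: P_flat.
  have := is_derive_mulmx dP (is_derive_cst (Psicl v) s 1).
  have alg (a p c : 'M[Cplx R]_mu) : - (a *m p) *m c + p *m 0 = - (a *m (p *m c)).
    by rewrite mulmx0 addr0 mulNmx mulmxA.
  by rewrite alg.
have cl_der (v : Cplx R) :
    is_derive v 1 Psicl (- (q_N0 Q 0 + cexp v *: q_N1 Q 0) *m Psicl v).
  (* Flat sections are the case of right factor 0 in [classical_limit]. *)
  have T_der (w : Cplx R) : exists L : 'M[Cplx R]_mu,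
      is_derive w 1 (fun=> 0 : 'M[Cplx R]_mu) L.
    by exists 0; exact: is_derive_cst.
  have G_der k (w : Cplx R) : (k0 <= k)%N ->
    is_derive w 1 (fun y => P (- k%:R, cexp y) *m Psicl y)
      (P (- k%:R, cexp w) *m Psicl w *m 0
       - conn_tau (q_N0 Q) (q_N1 Q) (cexp (- k%:R), cexp w)
         *m (P (- k%:R, cexp w) *m Psicl w)).
    move=> /Hk0 rk.
    have -> : (fun y => P (- k%:R, cexp y) *m Psicl y) = (fun y => Psi (- k%:R, y)).
      by apply/funext => y; rewrite PsiE.
    have alg (x a b : 'M[Cplx R]_mu) : x *m 0 - a *m b = - (a *m b).
      by rewrite mulmx0 add0r.
    rewrite alg -PsiE //.
    exact: (flat_basis_derive w Psi_basis (to_rho _ rk)).2.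
  have := classical_limit r_gt0 H_holo H_0 T_der G_der v.
  have alg (x a : 'M[Cplx R]_mu) : x *m 0 - a *m x = - a *m x.
    by rewrite mulmx0 add0r mulNmx.
  by rewrite alg.
exists Psicl; split; [exact: PsiE|exact: cl_der|].
move=> [_ [delta [Rk [comm Hconf]]]].
(* The point v = 0 is tau = 1, where both powers of tau are the identity. *)
exists (Psicl 0); apply: classical_solution => //.
apply: (conformal_residue comm) => v.
(* Solved for the derivative, the conformal equation reads tau dP/dtau = P T - B P, which is the
   hypothesis of [classical_limit] with G = 1. *)
pose T w := \sum_(k < delta.+1) cexp w ^+ k *: Rk k.
have T_der (w : Cplx R) : exists L, is_derive w 1 T L.
  exact: poly_cexp_derivable.
have G_der k (w : Cplx R) : (k0 <= k)%N ->
  is_derive w 1 (fun y => P (- k%:R, cexp y) *m 1%:M)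
    (P (- k%:R, cexp w) *m 1%:M *m T w
     - conn_tau (q_N0 Q) (q_N1 Q) (cexp (- k%:R), cexp w)
       *m (P (- k%:R, cexp w) *m 1%:M)).
  move=> /Hk0 rk; set x : Cplx R := - k%:R in rk *.
  have [_ HT] := Hconf x (cexp w) rk (cexp_neq0 w).
  have dP : is_derive w 1 (fun y => P (x, cexp y)) (tdt P (x, cexp w)).
    apply: (is_derive_chain (f := fun y => P (x, y)) (is_derive_cexp w)).
    apply/is_derive_partial2/derivableP/diff_derivable.
    by apply: P_holo; split.
  have alg (p b t d : 'M[Cplx R]_mu) : p \in unitmx ->
      invmx p *m b *m p + invmx p *m d = t -> d = p *m 1%:M *m t - b *m (p *m 1%:M).
    move=> up <-; rewrite mulmx1 mulmxDr !mulmxA mulmxV // !mul1mx.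
    by rewrite addrC addKr.
  rewrite -(alg _ _ _ _ (P_unit _ _ rk) HT).
  have -> : (fun y => P (x, cexp y) *m 1%:M) = (fun y => P (x, cexp y)).
    by apply/funext => y; rewrite mulmx1.
  exact: dP.
(* The limit equation gives T - [cl] as derivative of the constant 1, so T is the classical
   matrix. *)
have D1 := classical_limit r_gt0 H_holo H_0 T_der G_der v.
have D2 : is_derive v 1 (fun=> 1%:M : 'M[Cplx R]_mu) 0 by exact: is_derive_cst.
have := etrans (esym (@derive_val _ _ _ _ _ _ _ D1)) (@derive_val _ _ _ _ _ _ _ D2).
rewrite mul1mx mulmx1 => /eqP; rewrite subr_eq0 => /eqP ET.
exact: ET.
Qed.
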